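(* Let $N\ge2$ and let $\mu=\sum_{\ell=1}^M w_\ell\delta_{\theta_\ell}$ be an $N$-admissible atomic probability measure. (i) Sharp Poisson and inverse powers. For every $0<q<1$, \[ \sum_{k\ge1}q^k|\widehat\mu(k)|^2\ \ge\ \frac{q^N}{1-q^N}. \] Equality for one $q$ holds if and only if $\mu=\sigma_{N,\gamma}$ for some $\gamma$; in that case equality holds for every $q\in(0,1)$. Moreover, for every $p>1$, \[ \sum_{k\ge1}\frac{|\widehat\mu(k)|^2}{k^p}\ \ge\ \frac{\zeta(p)}{N^p}, \] with the same equality cases. If $\widehat\mu(1)=0$, the sum starts at $k=2$. Assume from now on that $\widehat\mu(1)=0$, and append zero weights if $M<N$ (that is, set $w_\ell=0$ for $M<\ell\le N$). (ii) Weight rigidity. \[ \sum_{\ell=1}^{N}\Bigl(w_\ell-\frac1N\Bigr)^2\le2e^4N^2d_{3,N}(\mu), \] so \[ N-M\le2e^4N^4d_{3,N}(\mu),\qquad \max_\ell|Nw_\ell-1|^2\le2e^4N^4d_{3,N}(\mu). \] (iii) Low-band coercivity. For every fixed $0<\alpha<1$ there are $N_\alpha,C_\alpha$ (depending only on $\alpha$) such that \[ \sum_{k=2}^{\lfloor\alpha N\rfloor}\frac{|\widehat\mu(k)|^2}{k^3}\le C_\alpha d_{3,N}(\mu)\qquad(N\ge N_\alpha). \] For $N\ge20$, \[ \sum_{k=2}^{\lfloor N/10\rfloor}\frac{|\widehat\mu(k)|^2}{k^3}\le\frac54\,d_{3,N}(\mu). \] (iv) Microscopic lattice rigidity. Let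 $N_\nu\to\infty$ and let $\mu_\nu$ be $N_\nu$-admissible measures with $\widehat{\mu_\nu}(1)=0$ and $N_\nu^4d_{3,N_\nu}(\mu_\nu)\to0$. Then for all large $\nu$ the measure $\mu_\nu$ has exactly $N_\nu$ atoms. In cyclic order (writing $N=N_\nu$, $\mu=\mu_\nu$), the quantities \[ \varepsilon_j=Nw_j-1,\qquad \theta_{j+1}-\theta_j=\frac{2\pi}{N}(1+\eta_j) \] satisfy \[ \max_j(|\varepsilon_j|+|\eta_j|)\to0,\qquad \sum_j(\varepsilon_j^2+\eta_j^2)\le C N^4d_{3,N}(\mu). \] After a common rotation and cyclic relabeling, write $\theta_j=\gamma+jh+y_j$ with $\sum_jy_j=0$, $u_j=w_j-N^{-1}$, $h=2\pi/N$. With $B_N=N^4d_{3,N}(\mu)$, \[ \sum_j|y_j|^2\le CB_N,\quad \max_j|y_j|\le C\sqrt{B_N/N},\quad \sum_j|u_j|^2\le \frac{CB_N}{N^2},\quad \max_j|u_j|\le \frac{CB_N^{1/2}}{N}. \] Here $C$ is an absolute constant (the estimates hold for all large $\nu$).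
   Context: For $N\ge2$, an $N$-admissible atomic probability measure on the circle $\mathbb R/2\pi\mathbb Z$ is $\mu=\sum_{\ell=1}^M w_\ell\delta_{\theta_\ell}$ with $1\le M\le N$, $w_\ell>0$, $\sum_\ell w_\ell=1$, and nodes $\theta_\ell$ distinct modulo $2\pi$. Its Fourier coefficients are $\widehat\mu(k)=\sum_\ell w_\ell e^{-ik\theta_\ell}$. For $\gamma\in\mathbb R$, $\sigma_{N,\gamma}=\frac1N\sum_{j=0}^{N-1}\delta_{\gamma+2\pi j/N}$. For $p>1$, \[ d_{p,N}(\mu)=\sum_{k\ge2}\frac{|\widehat\mu(k)|^2}{k^p}-\frac{\zeta(p)}{N^p}. \] In cyclic order means that the nodes are lifted increasingly to $\mathbb R$ with $\theta_{j+N}=\theta_j+2\pi$. *)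

(* Defs.v *)
From HB Require Import structures.
From mathcomp Require Import all_boot all_order all_algebra.
From mathcomp Require Import all_classical all_reals all_analysis.
From mathcomp Require Import complex.

Set Implicit Arguments.
Unset Strict Implicit.
Unset Printing Implicit Defensive.

Import Order.TTheory GRing.Theory Num.Theory.
Import numFieldNormedType.Exports.

Local Open Scope classical_set_scope.
Local Open Scope ring_scope.

(* Real-valued series; the library's \sum_(m <= k <oo) is for \bar R only. *)
Notation "'\rsum_' ( m <= k <oo ) F" :=
  (\big[+%R/0%R]_(m%N <= k <oo) F%R)
  (at level 41, F at level 41, k, m at level 50,
   format "'[' '\rsum_' ( m  <=  k  <oo ) '/  '  F ']'") : ring_scope.

Definition zeta (R : realType) (p : R) : R :=
  \rsum_(1 <= k <oo) (k%:R `^ p)^-1.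

Definition eq_mod_2pi (R : realType) (x y : R) : Prop :=
  exists z : int, x = y + z%:~R * (2 * pi).

(* An atomic probability measure on R/2piZ; the nodes are representatives
   in R of distinct points of the circle. *)
Record atomic_prob (R : realType) := AtomicProb {
  atoms : nat;
  weight : 'I_atoms -> R;
  node : 'I_atoms -> R;
  weight_gt0 : forall l, 0 < weight l;
  weight_sum1 : \sum_(l < atoms) weight l = 1;
  node_distinct : forall l l', eq_mod_2pi (node l) (node l') -> l = l' }.

Definition admissible (R : realType) (N : nat) (mu : atomic_prob R) : Prop :=
  (1 <= atoms mu <= N)%N.

Definition dirac_sum (R : realType) (M : nat) (w theta : 'I_M -> R)
    (A : set R) : \bar R :=
  (\sum_(l < M) (w l)%:E * \d_(theta l) A)%E.

Definition circle_measure (R : realType) (mu : atomic_prob R) :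
    set R -> \bar R :=
  dirac_sum (@weight R mu) (@node R mu).

Definition lattice_measure (R : realType) (N : nat) (gamma : R) : set R -> \bar R :=
  dirac_sum (fun _ : 'I_N => N%:R^-1)
            (fun j : 'I_N => gamma + 2 * pi * j%:R / N%:R).

(* Borel subsets of R/2piZ are identified with 2pi-periodic Borel subsets
   of R; two measures on the circle are equal when they agree on these. *)
Definition eq_circle_measure (R : realType) (m1 m2 : set R -> \bar R) : Prop :=
  forall A : set R, measurable A ->
    (forall x, A (x + 2 * pi) <-> A x) -> m1 A = m2 A.

(* expi t = exp(i t) *)
Definition expi (R : realType) (t : R) : R[i] := Complex (cos t) (sin t).

Definition fourier (R : realType) (mu : atomic_prob R) (k : nat) : R[i] :=
  \sum_(l < atoms mu)
    real_complex R (weight l) * expi (- (k%:R * node l)).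

Definition fourier_sq (R : realType) (mu : atomic_prob R) (k : nat) : R :=
  Normc.normc (fourier mu k) ^+ 2.

Definition defect (R : realType) (p : R) (N : nat) (mu : atomic_prob R) : R :=
  \rsum_(2 <= k <oo) (fourier_sq mu k / k%:R `^ p) - zeta p / N%:R `^ p.

(* The weights of mu, followed by zeros. *)
Definition padded_weight (R : realType) (mu : atomic_prob R) (l : nat) : R :=
  oapp (@weight R mu) 0 (insub l).

(* th lifts the nodes of mu increasingly to R, with th (j + N) = th j + 2 pi;
   lab j is the atom lying under th j.  These conditions force lab to be
   N-periodic, to be injective on each period, and atoms mu = N. *)
Definition cyclic_order (R : realType) (N : nat) (mu : atomic_prob R)
    (th : int -> R) (lab : int -> 'I_(atoms mu)) : Prop :=
  [/\ forall i j : int, i < j -> th i < th j,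
      forall j : int, th (j + N%:Z) = th j + 2 * pi,
      forall j : int, eq_mod_2pi (th j) (node (lab j)) &
      forall l : 'I_(atoms mu), exists j : int, lab j = l].

(* Main.v *)
(* Let a k be the squared Fourier coefficient, and let b tend to 0 with positive
   fourth differences, as q^k and k^-p do.  Weighting by w_l w_l' the cosine
   series b M + 2 \sum_(n >= 1) b (M + n) cos (n t) at t = theta_l - theta_l'
   and summing, we get a sequence V m, for M = m N, with
   V 0 = b 0 + 2 \sum_(k >= 1) b k a k.  Its second differences equal
   b ((m - 1) N) - b ((m + 1) N) plus three nonnegative terms: a combination of
   the a n with n < N, a multiple of the variance of the weights (the only place
   where atoms mu <= N is used), and the pair energy of a nonnegative kernel with
   a Fejer factor.  Hence
     \sum_k b k a k - \sum_m b (m N) >= low_energy + mass_energy + pair_energy,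
   which is (i); the three energies are zero only for a lattice.  For
   b k = k^-3 the mass energy gives (ii) and the low energy gives (iii).  For
   (iv), the weights are all about 1/N by (ii); a gap wider than 3 pi / N would
   contradict (iii) tested against an explicit trigonometric polynomial, and for
   shorter gaps the pair energy of neighbours dominates the squares of the
   eta_j, from which the drift y_j follows by Cauchy-Schwarz. *)

Require Import Defs.
From HB Require Import structures.
From mathcomp Require Import all_boot all_order all_algebra.
From mathcomp Require Import all_classical all_reals all_analysis.
From mathcomp Require Import complex.
From mathcomp Require Import zify ring lra.

Set Implicit Arguments.
Unset Strict Implicit.
Unset Printing Implicit Defensive.

Import Order.TTheory GRing.Theory Num.Theory.
Import numFieldNormedType.Exports.

Local Open Scope classical_set_scope.
Local Open Scope ring_scope.

(** * Cosine sums and summation by parts *)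

(** For a fixed difference t, the second difference in steps of N multiplies the tail series by -(2
    - 2 cos (N t)), up to corrections at frequencies below N; and 2 - 2 cos (N t) is 2 - 2 cos t
    times the unnormalised Fejer kernel F. Two rounds of summation by parts write 2 - 2 cos t times
    the tail as d - 2 Q / (2 - 2 cos t), where d is a jump of b and Q combines the functions 1 - cos
    (n t) with the fourth differences of b: hence the order four. The term d F produces the
    corrections in the low coefficients and in the variance term. The second differences are summed
    with weight m, which returns V 0 and cancels b 0; among the nonnegative remainders only that of
    m = 1 is kept. The exact identities are for finitely supported b. A general b is reached through
    truncations of its fourth differences, which preserve all signs and stay below b. The pair
    energy is cut at a fixed index T before this limit: T = 1 already settles equality, while T near
    N / 3 gives the gaps their full quadratic weight. *)

Section CosineSums.
Variable R : realType.
Implicit Types (t : R) (v b : nat -> R).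

Lemma mul2_cos_cos (x y : R) : 2 * cos x * cos y = cos (x + y) + cos (x - y).
Proof. rewrite cosB cosD; ring. Qed.

Lemma cosS_rec t n :
  cos (n.+2%:R * t) = 2 * cos t * cos (n.+1%:R * t) - cos (n%:R * t).
Proof.
rewrite mul2_cos_cos -[t - _]opprB cosN.
rewrite (_ : t + _ = n.+2%:R * t); last by rewrite -!natr1; ring.
rewrite (_ : _ - t = n%:R * t); last by rewrite -!natr1; ring.
by rewrite addrK.
Qed.

Lemma cos_periodicz (x : R) (z : int) : cos (x + z%:~R * (2 * pi)) = cos x.
Proof.
have pos (n : nat) (y : R) : cos (y + n%:R * (2 * pi)) = cos y.
  rewrite -[RHS](periodicn (@cosD2pi R) n y); congr (cos (_ + _)).
  by rewrite -[RHS]mulr_natl -[pi *+ 2]mulr_natl.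
case: z => n; first exact: pos.
rewrite NegzE mulrNz mulNr -[in RHS](subrK (n.+1%:R * (2 * pi)) x) pos.
by rewrite pmulrn.
Qed.

(** N times the usual Fejer kernel: (sin (N t / 2) / sin (t / 2))^2 off 2 pi Z, and N^2 at 0. *)
Definition fejer N t : R :=
  N%:R + 2 * \sum_(1 <= k < N) (N - k)%:R * cos (k%:R * t).

Lemma fejerS N t :
  fejer N.+1 t = fejer N t + (1 + 2 * \sum_(1 <= k < N.+1) cos (k%:R * t)).
Proof.
have -> : fejer N t =
    N%:R + 2 * \sum_(1 <= k < N.+1) (N - k)%:R * cos (k%:R * t).
  rewrite /fejer; case: N => [|N]; first by rewrite !big_geq.
  by rewrite [in RHS]big_nat_recr //= subnn mul0r addr0.
rewrite /fejer -natr1 [X in 2 * X](_ : _ =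
  \sum_(1 <= k < N.+1) (N - k)%:R * cos (k%:R * t) +
  \sum_(1 <= k < N.+1) cos (k%:R * t)); first ring.
rewrite -big_split; apply: eq_big_nat => k /andP[_ kN] /=.
by rewrite subSn // -natr1; ring.
Qed.

Lemma fejerE N t :
  (2 - 2 * cos t) * fejer N t = 2 - 2 * cos (N%:R * t).
Proof.
(* The bracket is the Dirichlet kernel; times 2 - 2 cos t it is a difference of consecutive cosines,
   so the increments in [fejerS] telescope. *)
have dir n : (2 - 2 * cos t) * (1 + 2 * \sum_(1 <= k < n.+1) cos (k%:R * t)) =
    2 * cos (n%:R * t) - 2 * cos (n.+1%:R * t).
  elim: n => [|n IH]; first by rewrite big_geq // mul0r cos0 mul1r; ring.
  by rewrite big_nat_recr //= cosS_rec; lra.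
elim: N => [|N IH]; first by rewrite /fejer big_geq // mul0r cos0; ring.
by rewrite fejerS mulrDr IH dir; ring.
Qed.

Lemma fejer0 N : fejer N 0 = N%:R ^+ 2.
Proof.
elim: N => [|N IH]; first by rewrite /fejer big_geq //; ring.
rewrite fejerS IH -natr1; under eq_bigr do rewrite mulr0 cos0.
by rewrite big_const_nat iter_addr_0 subSS subn0; ring.
Qed.

(** On cosine coefficients, multiplication by 2 - 2 cos t is minus the second difference; the last
    two terms are what the cut at [T] leaves. The series starts at [v 1], so that [v 0] remains free
    for [abel_cos4]. *)
Lemma abel_cos2 v T t :
  (2 - 2 * cos t) *
    (v 1%N + 2 * \sum_(1 <= n < T.+1) v n.+1 * cos (n%:R * t)) =
  2 * (v 1%N - v 2%N)
  - 2 * (\sum_(1 <= n < T.+1) (v n - 2 * v n.+1 + v n.+2) * cos (n%:R * t))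
  - 2 * v T.+1 * cos (T.+1%:R * t) + 2 * v T.+2 * cos (T%:R * t).
Proof.
elim: T => [|T IH]; first by rewrite !big_geq // mul1r mul0r cos0; ring.
by rewrite !(@big_nat_recr _ _ _ T.+1) //= !cosS_rec; rewrite ?cosS_rec in IH *; lra.
Qed.

Definition diff v k : R := v k - v k.+1.
Definition diff4 v := diff (diff (diff (diff v))).

Lemma diff4E v k : diff4 v k =
  v k - 4 * v k.+1 + 6 * v k.+2 - 4 * v k.+3 + v k.+4.
Proof. rewrite /diff4 /diff; ring. Qed.

Lemma sum_diff v m n : (m <= n)%N -> \sum_(m <= k < n) diff v k = v m - v n.
Proof.
move=> mn; rewrite /diff -[RHS]opprB -(telescope_sumr v mn) -sumrN.
by apply: eq_bigr => k _; rewrite opprB.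
Qed.

(* Twice summed by parts, the cosine series of a 4-monotone sequence becomes a
   nonnegative combination of the functions 1 - cos (n t). *)
Lemma abel_cos4 v T t : (forall n, (T <= n)%N -> v n = 0) ->
  (2 - 2 * cos t) * (v 0%N - v 2%N - (2 - 2 * cos t) *
    (v 1%N + 2 * \sum_(1 <= n < T.+1) v n.+1 * cos (n%:R * t))) =
  2 * \sum_(1 <= n < T.+1) diff4 v n.-1 * (1 - cos (n%:R * t)).
Proof.
move=> v0.
pose D n := v n - 2 * v n.+1 + v n.+2.
have D0 n : (T <= n)%N -> D n = 0 by move=> Tn; rewrite /D !v0; [ring|lia..].
have E1 := abel_cos2 v T t; rewrite !(v0 T.+1, v0 T.+2) // in E1; [|lia..].
rewrite mulr0 !mul0r subr0 addr0 in E1.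
(* The shift puts [D 0] in the place of the constant coefficient. *)
have E2 := abel_cos2 (fun n => D n.-1) T t.
rewrite /= (D0 T) // (D0 T.+1) // mulr0 !mul0r subr0 addr0 in E2.
(* The constant left over is the sum of the same coefficients, which turns each [- cos] into
   [1 - cos]. *)
have E3 : D 0%N - D 1%N = \sum_(1 <= n < T.+1) diff4 v n.-1.
  transitivity ((D 0%N - D 1%N) - (D T - D T.+1)).
    by rewrite (D0 T) // (D0 T.+1) // !subr0.
  rewrite big_add1 /= -(sum_diff (fun n => D n - D n.+1)) //.
  by apply: eq_bigr => n _; rewrite diff4E /diff /D; ring.
have E4 : \sum_(1 <= n < T.+1) (D n.-1 - 2 * D n + D n.+1) * cos (n%:R * t) =
  \sum_(1 <= n < T.+1) diff4 v n.-1 * cos (n%:R * t).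
  apply: eq_big_nat => -[|n] // _ /=; rewrite diff4E /D; ring.
rewrite E1.
have -> : v 0%N - v 2%N - (2 * (v 1%N - v 2%N) -
    2 * (\sum_(1 <= n < T.+1) D n * cos (n%:R * t))) =
    D 0%N + 2 * \sum_(1 <= n < T.+1) D n * cos (n%:R * t).
  rewrite /D; ring.
rewrite E2 E4 E3 -mulrBr -sumrB; congr (2 * _).
by apply: eq_bigr => n _; ring.
Qed.

Definition cos_tail b T M t : R :=
  b M + 2 * \sum_(1 <= n < T.+1) b (M + n)%N * cos (n%:R * t).

(** The product formula splits cos (N t) cos (n t) into frequencies n + N and n - N. The first
    family is the series at [P] without its start, the second is the series at [P + N + N] preceded
    by reflected terms; the last sum corrects the frequencies below [N]. *)
Lemma cos_tail_shift b T P N t : (0 < N <= T)%N ->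
  (forall n, (T < n)%N -> b n = 0) ->
  2 * cos (N%:R * t) * cos_tail b T (P + N) t =
  cos_tail b T P t + cos_tail b T (P + N + N) t
  + (b (P + N + N)%N - b P)
  + 2 * \sum_(1 <= n < N) (b (P + N + N - n)%N - b (P + n)%N) * cos (n%:R * t).
Proof.
move=> /andP[N0 NT] b0.
have c2 n : 2 * cos (N%:R * t) * cos (n%:R * t) =
    cos ((n + N)%:R * t) + cos (n%:R * t - N%:R * t).
  by rewrite mulrAC mul2_cos_cos natrD mulrDl.
have E1 : \sum_(1 <= n < T.+1) b (P + N + n)%N * cos ((n + N)%:R * t) =
    \sum_(1 <= n < T.+1) b (P + n)%N * cos (n%:R * t)
    - \sum_(1 <= n < N) b (P + n)%N * cos (n%:R * t)
    - b (P + N)%N * cos (N%:R * t).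
  rewrite [X in _ = X - _ - _](@big_cat_nat _ _ _ N) //=; last by lia.
  rewrite [X in _ = X - _ - _]addrC addrK [X in _ = X - _]big_ltn //.
  rewrite [X in _ = X - _]addrC addrK.
  have -> : \sum_(N.+1 <= n < T.+1) b (P + n)%N * cos (n%:R * t) =
    \sum_(N.+1 <= n < T.+1 + N) b (P + n)%N * cos (n%:R * t).
    rewrite [RHS](@big_cat_nat _ _ _ T.+1) //=; last by lia.
    rewrite [X in _ = _ + X]big_nat_cond [X in _ = _ + X]big1 ?addr0 // => n.
    by rewrite andbT => /andP[Tn _]; rewrite b0 ?mul0r //; lia.
  rewrite -[N.+1]add1n big_addn addnK; apply: eq_bigr => n _.
  by congr (b _ * _); lia.
(* For n < N the frequency n - N is negative and is reflected by evenness; n = N supplies the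
   constant [b (P + N + N)]. *)
have E2 : \sum_(1 <= n < T.+1) b (P + N + n)%N * cos (n%:R * t - N%:R * t) =
    \sum_(1 <= n < N) b (P + N + N - n)%N * cos (n%:R * t) + b (P + N + N)%N
    + \sum_(1 <= n < T.+1) b (P + N + N + n)%N * cos (n%:R * t).
  rewrite (@big_cat_nat _ _ _ N) //=; last by lia.
  rewrite [X in _ + X = _]big_ltn; last by lia.
  rewrite subrr cos0 mulr1 addrA; congr (_ + _ + _).
    rewrite big_nat_rev /=; apply: eq_big_nat => n /andP[n1 nN].
    rewrite add1n subSS natrB ?(ltnW nN) //.
    rewrite (_ : _ - N%:R * t = - (n%:R * t)); last by ring.
    by rewrite cosN; congr (b _ * _); lia.
  rewrite [RHS](@big_cat_nat _ _ _ (T.+1 - N)) //=; [|lia|lia].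
  rewrite [X in _ = _ + X]big_nat_cond [X in _ = _ + X]big1 ?addr0; last first.
    by move=> n; rewrite andbT => /andP[Tn _]; rewrite b0 ?mul0r //; lia.
  rewrite -[N.+1]add1n big_addn; apply: eq_bigr => n _.
  by congr (b _ * cos _); [lia|rewrite natrD; ring].
have E : 2 * cos (N%:R * t) *
    \sum_(1 <= n < T.+1) b (P + N + n)%N * cos (n%:R * t) =
    \sum_(1 <= n < T.+1) b (P + N + n)%N * cos ((n + N)%:R * t)
    + \sum_(1 <= n < T.+1) b (P + N + n)%N * cos (n%:R * t - N%:R * t).
  rewrite mulr_sumr -big_split /=; apply: eq_bigr => n _.
  by rewrite mulrCA c2 mulrDr.
rewrite /cos_tail mulrDr (mulrCA _ 2) E E1 E2.
have -> : \sum_(1 <= n < N) (b (P + N + N - n)%N - b (P + n)%N) * cos (n%:R * t) =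
  \sum_(1 <= n < N) b (P + N + N - n)%N * cos (n%:R * t) -
  \sum_(1 <= n < N) b (P + n)%N * cos (n%:R * t).
  by rewrite -sumrB; apply: eq_bigr => n _; rewrite mulrBl.
ring.
Qed.

End CosineSums.

(** * The energy inequality *)

Section FourierSquares.
Variables (R : realType) (mu : atomic_prob R).

(** The mean of [g] over differences of two independent points of [mu]. By linearity a pointwise
    identity in t becomes one between Fourier squares, and t need only be a node difference: 0
    itself, or a value with cos t < 1. *)
Definition pair_sum (g : R -> R) : R :=
  \sum_(l < atoms mu) \sum_(l' < atoms mu)
    weight l * weight l' * g (node l - node l').

Lemma eq_pair_sum (f g : R -> R) :
  (forall l l' : 'I_(atoms mu), f (node l - node l') = g (node l - node l')) ->
  pair_sum f = pair_sum g.
Proof. by move=> fg; apply: eq_bigr => l _; apply: eq_bigr => l' _; rewrite fg. Qed.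

Lemma pair_sumD f g : pair_sum (fun t => f t + g t) = pair_sum f + pair_sum g.
Proof.
rewrite /pair_sum -big_split; apply: eq_bigr => l _ /=.
by rewrite -big_split; apply: eq_bigr => l' _ /=; rewrite mulrDr.
Qed.

Lemma pair_sumZ c g : pair_sum (fun t => c * g t) = c * pair_sum g.
Proof.
rewrite /pair_sum mulr_sumr; apply: eq_bigr => l _ /=.
by rewrite mulr_sumr; apply: eq_bigr => l' _ /=; ring.
Qed.

Lemma pair_sum_cst c : pair_sum (fun=> c) = c.
Proof.
rewrite /pair_sum; under eq_bigr do rewrite -mulr_suml -mulr_sumr weight_sum1 mulr1.
by rewrite -mulr_suml weight_sum1 mul1r.
Qed.

Lemma pair_sum_sum m n (c : nat -> R) (g : nat -> R -> R) :
  pair_sum (fun t => \sum_(m <= k < n) c k * g k t) =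
  \sum_(m <= k < n) c k * pair_sum (g k).
Proof.
under [RHS]eq_bigr do rewrite -pair_sumZ.
rewrite /pair_sum [RHS]exchange_big /=; apply: eq_bigr => l _.
by rewrite [RHS]exchange_big /=; apply: eq_bigr => l' _; rewrite mulr_sumr.
Qed.

Lemma pair_sum_ge0 g :
  (forall l l' : 'I_(atoms mu), 0 <= g (node l - node l')) -> 0 <= pair_sum g.
Proof.
move=> g0; apply: sumr_ge0 => l _; apply: sumr_ge0 => l' _.
by rewrite mulr_ge0 // mulr_ge0 // ltW // weight_gt0.
Qed.

Lemma fourierE k : fourier mu k =
  Complex (\sum_(l < atoms mu) weight l * cos (k%:R * node l))
    (- \sum_(l < atoms mu) weight l * sin (k%:R * node l)).
Proof.
have E (I : finType) (f g : I -> R) :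
    \sum_i Complex (f i) (g i) = Complex (\sum_i f i) (\sum_i g i).
  by elim/big_rec3: _ => // i x y z _ ->.
rewrite -sumrN -E; apply: eq_bigr => l _; rewrite /expi cosN sinN /=.
by rewrite /real_complex_def; apply/eqP; rewrite eq_complex /=; apply/andP; split; apply/eqP; ring.
Qed.

Lemma fourier_sqE k : fourier_sq mu k =
  (\sum_(l < atoms mu) weight l * cos (k%:R * node l)) ^+ 2 +
  (\sum_(l < atoms mu) weight l * sin (k%:R * node l)) ^+ 2.
Proof.
by rewrite /fourier_sq fourierE /= sqr_sqrtr ?sqrrN // addr_ge0 ?sqr_ge0.
Qed.

Lemma pair_sum_cos k : pair_sum (fun t => cos (k%:R * t)) = fourier_sq mu k.
Proof.
rewrite fourier_sqE !expr2 !mulr_suml -big_split; apply: eq_bigr => l _ /=.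
rewrite !mulr_sumr -big_split; apply: eq_bigr => l' _ /=.
by rewrite mulrBr cosB; ring.
Qed.

Lemma pair_sum_cos_sum m n (c : nat -> R) :
  pair_sum (fun t => \sum_(m <= k < n) c k * cos (k%:R * t)) =
  \sum_(m <= k < n) c k * fourier_sq mu k.
Proof. by rewrite pair_sum_sum; under eq_bigr do rewrite pair_sum_cos. Qed.

Lemma fourier_sq_ge0 k : 0 <= fourier_sq mu k.
Proof. by rewrite fourier_sqE addr_ge0 ?sqr_ge0. Qed.

Lemma fourier_sq_le1 k : fourier_sq mu k <= 1.
Proof.
rewrite -pair_sum_cos -[leRHS](pair_sum_cst 1) -subr_ge0.
rewrite -[X in _ <= _ - X]mul1r -mulNr -pair_sumZ -pair_sumD; apply: pair_sum_ge0.
by move=> l l'; have := cos_le1 (k%:R * (node l - node l')); lra.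
Qed.

Lemma fourier_sq0 : fourier mu 1 = 0 -> fourier_sq mu 1 = 0.
Proof. by rewrite /fourier_sq => ->; rewrite Normc.normc0 expr0n. Qed.

Lemma cos_eq1 (t : R) : cos t = 1 -> eq_mod_2pi t 0.
Proof.
move=> ct; have pi0 := @pi_gt0 R.
(* Reduces t to [-pi, pi), whose absolute values lie where [cos] is injective. *)
pose z := Num.floor ((t + pi) / (2 * pi)).
have /andP[z1 z2] : z%:~R <= (t + pi) / (2 * pi) < (z + 1)%:~R.
  by rewrite floor_le_tmp floorD1_gt.
exists z; rewrite add0r.
have p2 : 0 < 2 * pi :> R by lra.
move: z1 z2; rewrite ler_pdivlMr // ltr_pdivrMr // intrD => z1 z2.
set s := t - z%:~R * (2 * pi).
have cs : cos s = 1.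
  by rewrite /s -mulNr -mulrNz cos_periodicz.
have ns : cos `|s| = cos 0 by rewrite cos_norm cos0.
have : `|s| = 0.
  apply: (@cos_inj R) => //; rewrite in_itv /= ?lexx ?pi_ge0 // normr_ge0 ler_norml.
  rewrite /s; lra.
by move/eqP; rewrite normr_eq0 subr_eq0 => /eqP.
Qed.

Lemma eq_mod_2piP (x y : R) : eq_mod_2pi x y <-> cos (x - y) = 1.
Proof.
split=> [[z ->]|/cos_eq1[z]]; first by rewrite addrAC subrr cos_periodicz cos0.
by rewrite add0r => /(canRL (subrK _)) ->; exists z; rewrite addrC.
Qed.

Lemma cos_node_lt1 (l l' : 'I_(atoms mu)) :
  l != l' -> cos (node l - node l') < 1.
Proof.
move=> ll'; rewrite lt_neqAle cos_le1 andbT; apply: contra ll' => /eqP c1.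
by apply/eqP/node_distinct/eq_mod_2piP.
Qed.

End FourierSquares.

(** * The energy inequality for finitely supported sequences *)

Section FiniteEnergy.
Variable R : realType.
Implicit Types b : nat -> R.

Lemma diff_ge0 b T : (forall n, (T < n)%N -> b n = 0) ->
  (forall k, (0 < k)%N -> 0 <= diff b k) -> forall k, (0 < k)%N -> 0 <= b k.
Proof.
move=> b0 db k k0; suff: 0 <= b k - b (k + T.+1)%N by rewrite (b0 (k + T.+1)%N) ?subr0 //; lia.
rewrite -sum_diff ?leq_addr // big_nat_cond sumr_ge0 // => i; rewrite andbT.
by move=> /andP[ki _]; apply: db; lia.
Qed.

Lemma diff_supp b T : (forall n, (T < n)%N -> b n = 0) ->
  forall n, (T < n)%N -> diff b n = 0.
Proof. by move=> b0 n Tn; rewrite /diff !b0 ?subrr // ltnW. Qed.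

(* i |-> b (M - i) - b (M + i) vanishes at 0 and is convex for i >= 0 since the
   second difference of b is nonincreasing. *)
Lemma odd_convex b M i :
  (forall k, (0 < k)%N -> 0 <= diff (diff (diff b)) k) -> (i < M)%N ->
  i%:R * (b M.-1 - b M.+1) <= b (M - i)%N - b (M + i)%N.
Proof.
move=> d3.
have d2 k j : (0 < k)%N -> diff (diff b) (k + j)%N <= diff (diff b) k.
  move=> k0; elim: j => [|j IH]; first by rewrite addn0.
  by apply: le_trans IH; rewrite addnS -subr_ge0 d3 //; lia.
have slope j : (j.+1 < M)%N -> b M.-1 - b M.+1 <=
    (b (M - j.+1)%N - b (M + j.+1)%N) - (b (M - j)%N - b (M + j)%N).
  elim: j => [|j IH jM]; first by rewrite subn0 addn0 subn1 addn1 subrr subr0.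
  apply: le_trans (IH (ltnW jM)) _.
  have := d2 (M - j.+2)%N (j.+1 + j.+1)%N ltac:(lia).
  rewrite (_ : M - j.+2 + _ = M + j)%N; last by lia.
  rewrite /diff (_ : (M - j.+2).+1 = M - j.+1)%N; last by lia.
  rewrite (_ : (M - j.+1).+1 = M - j)%N; last by lia.
  rewrite !addnS; lra.
elim: i => [|i IH] iM; first by rewrite mul0r subn0 addn0 subrr.
by have := slope _ iM; have := IH (ltnW iM); rewrite -natr1; lra.
Qed.

Lemma sum_diff2 (V : nat -> R) K :
  \sum_(1 <= m < K.+1) m%:R * (V m.-1 - 2 * V m + V m.+1) =
  V 0%N - K.+1%:R * V K + K%:R * V K.+1.
Proof.
elim: K => [|K IH]; first by rewrite big_geq //; ring.
by rewrite big_nat_recr //= IH -!natr1; ring.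
Qed.

(** The same weight applied to the explicit part of the second differences of V. Its [be 0] cancels
    the b 0 contained in V 0, whatever value 0 to a negative power receives. *)
Lemma sum_mul_diff (be : nat -> R) K :
  \sum_(1 <= m < K.+1) m%:R * (be m.-1 - be m.+1) =
  be 0%N + 2 * (\sum_(1 <= m < K.+1) be m) - K.+1%:R * be K - K%:R * be K.+1.
Proof.
elim: K => [|K IH]; first by rewrite !big_geq //; ring.
by rewrite !(@big_nat_recr _ _ _ K.+1) //= IH -!natr1; ring.
Qed.

Variable mu : atomic_prob R.
Local Notation a := (fourier_sq mu).

Definition sq_mass : R := \sum_(l < atoms mu) weight l ^+ 2.

(** At t = 0 the denominator vanishes and the convention on inverses makes the kernel 0: pairs l =
    l' contribute nothing here and are carried by [sq_mass]. *)
Definition kernel N T (c : nat -> R) t : R :=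
  fejer N t / (2 - 2 * cos t) * \sum_(1 <= n < T.+1) c n * (1 - cos (n%:R * t)).

Lemma fejer_ge0 N (l l' : 'I_(atoms mu)) : 0 <= fejer N (node l - node l') :> R.
Proof.
have [->|/cos_node_lt1 c1] := eqVneq l l'; first by rewrite subrr fejer0 sqr_ge0.
set t := node l - node l' in c1 *.
have c2 : 0 < 2 - 2 * cos t by lra.
rewrite -(pmulr_rge0 _ c2) fejerE; have := cos_le1 (N%:R * t); lra.
Qed.

Lemma kernel_ge0 N T c (l l' : 'I_(atoms mu)) :
  (forall n, (0 < n)%N -> 0 <= c n) -> 0 <= kernel N T c (node l - node l').
Proof.
move=> c0; apply: mulr_ge0.
  apply: divr_ge0; first exact: fejer_ge0.
  by have := cos_le1 (node l - node l'); lra.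
rewrite big_nat_cond sumr_ge0 // => n; rewrite andbT => /andP[n1 _].
by rewrite mulr_ge0 ?c0 // subr_ge0 cos_le1.
Qed.

(** Allows the pair energy to be cut at an index that stays fixed while the support of [b] grows. *)
Lemma kernel_le N T T' c (l l' : 'I_(atoms mu)) :
  (T' <= T)%N -> (forall n, (0 < n)%N -> 0 <= c n) ->
  kernel N T' c (node l - node l') <= kernel N T c (node l - node l').
Proof.
move=> TT' c0; apply: ler_wpM2l.
  apply: divr_ge0; first exact: fejer_ge0.
  by have := cos_le1 (node l - node l'); lra.
rewrite [leRHS](@big_cat_nat _ _ _ T'.+1) //= lerDl.
rewrite big_nat_cond sumr_ge0 // => n; rewrite andbT => /andP[n1 _].
by rewrite mulr_ge0 ?c0 ?subr_ge0 ?cos_le1 //; lia.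
Qed.

(** Half of the remainder at m = 1 in the second differences of V; [low_energy], [mass_energy] and
    [pair_energy] will be its three summands. *)
Definition gap_energy N T b : R :=
  \sum_(1 <= n < N)
     (b n - b (N + N - n)%N - (N - n)%:R * (b N.-1 - b N.+1)) * a n
  + 2^-1 * (b N.-1 - b N.+1) * (N%:R ^+ 2 * sq_mass - N%:R)
  + pair_sum mu (kernel N T (fun n => diff4 b (N + n - 2)%N)).

Lemma pair_sum_cos_tail b T M :
  pair_sum mu (cos_tail b T M) =
  b M + 2 * \sum_(1 <= n < T.+1) b (M + n)%N * a n.
Proof.
by rewrite pair_sumD pair_sum_cst pair_sumZ pair_sum_cos_sum.
Qed.

Lemma pair_sum_fejer N : pair_sum mu (fejer N) =
  N%:R + 2 * \sum_(1 <= k < N) (N - k)%:R * a k.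
Proof.
by rewrite pair_sumD pair_sum_cst pair_sumZ pair_sum_cos_sum.
Qed.

Lemma pair_sum_diag (g : R -> R) : (forall l l' : 'I_(atoms mu), l != l' ->
  g (node l - node l') = 0) -> pair_sum mu g = g 0 * sq_mass.
Proof.
move=> g0; rewrite /sq_mass mulr_sumr; apply: eq_bigr => l _.
rewrite (bigD1 l) //= big1 ?addr0; first by rewrite subrr; ring.
by move=> l'; rewrite eq_sym => /g0 ->; rewrite mulr0.
Qed.

(** By [fejerE] and [abel_cos4], 2 - 2 cos (N t) times the tail at [P + N] is d F minus twice the
    kernel. The mean of d F is d (N + 2 sum (N - n) a n), which explains the subtracted
    [(N - n)%:R * d] and [N%:R]. The bound [1 < P + N] keeps the indices of the fourth differences
    positive. *)
Lemma cos_tail_diff2 b T P N : (0 < N <= T)%N -> (1 < P + N)%N ->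
  (forall n, (T < n)%N -> b n = 0) ->
  let V M := pair_sum mu (cos_tail b T M) in
  let d := b (P + N).-1 - b (P + N).+1 in
  V P - 2 * V (P + N)%N + V (P + N + N)%N =
  (b P - b (P + N + N)%N)
  + 2 * \sum_(1 <= n < N)
      (b (P + n)%N - b (P + N + N - n)%N - (N - n)%:R * d) * a n
  + d * (N%:R ^+ 2 * sq_mass - N%:R)
  + 2 * pair_sum mu (kernel N T (fun n => diff4 b (P + N + n - 2)%N)).
Proof.
move=> NT PN b0 V d.
pose K := kernel N T (fun n => diff4 b (P + N + n - 2)%N).
pose one (t : R) : R := (cos t == 1)%:R.
have E : pair_sum mu (fun t => cos_tail b T P t +
    (- 2 * cos_tail b T (P + N) t + cos_tail b T (P + N + N) t)) =
  pair_sum mu (fun t => (b P - b (P + N + N)%N) + (2 * (\sum_(1 <= n < N)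
      (b (P + n)%N - b (P + N + N - n)%N) * cos (n%:R * t))
  + (- d * fejer N t + (d * N%:R ^+ 2 * one t + 2 * K t)))).
  apply: eq_pair_sum => l l'; set t := node l - node l'.
  have Sh := cos_tail_shift P t NT b0.
  have FE := fejerE N t.
  (* On the diagonal the left side and the kernel are 0 while d F is d N^2, which the indicator
     [one] removes. Off the diagonal, [abel_cos4] is divided by 2 - 2 cos t and multiplied by F. *)
  have key : (2 - 2 * cos (N%:R * t)) * cos_tail b T (P + N) t =
      d * fejer N t - d * N%:R ^+ 2 * one t - 2 * K t.
    have [ll'|/cos_node_lt1 c1] := eqVneq l l'.
      rewrite /K /kernel /one /t ll' subrr fejer0 mulr0 cos0 eqxx.
      by rewrite (mulr1 2) subrr invr0 /=; ring.
    rewrite -/t in c1.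
    have s0 : 2 - 2 * cos t != 0 by rewrite gt_eqF //; lra.
    have bz n : (T <= n)%N -> b (P + N + n).-1 = 0 by move=> Tn; rewrite b0 //; lia.
    have A4 := abel_cos4 t bz.
    rewrite -FE /K /kernel /one lt_eqF //.
    set F := fejer N t.
    rewrite -[LHS](mulfK s0) -[RHS](mulfK s0); congr (_ / _).
    set Q := \sum_(1 <= n < T.+1) diff4 b (P + N + n - 2)%N * (1 - cos (n%:R * t)).
    have A5 : (2 - 2 * cos t) * (d - (2 - 2 * cos t) * cos_tail b T (P + N) t) = 2 * Q.
      move: A4; rewrite addn0 addn2 addn1 /= /cos_tail.
      move=> A4.
      transitivity (2 * \sum_(1 <= n < T.+1)
       diff4 (fun n0 : nat => b (P + N + n0).-1) n.-1 * (1 - cos (n%:R * t))).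
        rewrite -A4; congr (_ * (_ - _ * (_ + 2 * _))).
        by apply: eq_bigr => n _; rewrite addnS.
      congr (2 * _); apply: eq_big_nat => n /andP[n1 _]; congr (_ * _).
      rewrite !diff4E; do ![congr (_ + _)|congr (- _)|congr (_ * _)|congr b]; lia.
    have -> : (d * F - d * N%:R ^+ 2 * false%:R - 2 * (F / (2 - 2 * cos t) * Q)) * (2 - 2 * cos t)
      = F * (d * (2 - 2 * cos t) - 2 * Q * ((2 - 2 * cos t)^-1 * (2 - 2 * cos t))).
      by rewrite /=; ring.
    by rewrite mulVf // mulr1 -A5; ring.
  have -> : \sum_(1 <= n < N) (b (P + n)%N - b (P + N + N - n)%N) * cos (n%:R * t) =
     - \sum_(1 <= n < N) (b (P + N + N - n)%N - b (P + n)%N) * cos (n%:R * t).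
    by rewrite -sumrN; apply: eq_bigr => n _; ring.
  lra.
move: E; rewrite !pair_sumD !pair_sumZ !pair_sum_cst !pair_sum_cos_sum.
rewrite ?pair_sum_fejer ?pair_sum_cos_tail.
have -> : pair_sum mu one = sq_mass.
  rewrite pair_sum_diag; first by rewrite /one cos0 eqxx mul1r.
  by move=> l l' /cos_node_lt1 c1; rewrite /one lt_eqF.
move=> EE; rewrite /V !pair_sum_cos_tail.
have -> : \sum_(1 <= n < N)
      (b (P + n)%N - b (P + N + N - n)%N - (N - n)%:R * d) * a n =
   \sum_(1 <= n < N) (b (P + n)%N - b (P + N + N - n)%N) * a n
   - d * \sum_(1 <= n < N) (N - n)%:R * a n.
  by rewrite mulr_sumr -sumrB; apply: eq_bigr => n _; ring.
rewrite -/K; lra.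
Qed.

Lemma gap_energy_finite N T T' b : (1 < N <= T)%N -> (T' <= T)%N ->
  0 <= N%:R * sq_mass - 1 ->
  (forall n, (T < n)%N -> b n = 0) -> (forall k, (0 < k)%N -> 0 <= diff4 b k) ->
  \sum_(1 <= m < T.+1) b (m * N)%N + gap_energy N T' b <=
  \sum_(1 <= k < T.+1) b k * a k.
Proof.
move=> /andP[N1 NT] TT' X0 b0 d4.
have s1 := diff_supp b0; have s2 := diff_supp s1; have s3 := diff_supp s2.
have d3 := diff_ge0 s3 d4; have d2 := diff_ge0 s2 d3; have d1 := diff_ge0 s1 d2.
pose V m := pair_sum mu (cos_tail b T (m * N)).
pose d m := b (m * N).-1 - b (m * N).+1.
pose Y m := 2 * \sum_(1 <= n < N)
      (b (m.-1 * N + n)%N - b (m.+1 * N - n)%N - (N - n)%:R * d m) * a n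
  + d m * (N%:R ^+ 2 * sq_mass - N%:R)
  + 2 * pair_sum mu (kernel N T (fun n => diff4 b (m * N + n - 2)%N)).
have VE m : (0 < m)%N -> V m.-1 - 2 * V m + V m.+1 =
    (b (m.-1 * N)%N - b (m.+1 * N)%N) + Y m.
  case: m => // m _.
  have := @cos_tail_diff2 b T (m * N) N ltac:(lia) ltac:(nia) b0.
  rewrite (_ : m * N + N = m.+1 * N)%N; last by rewrite mulSn addnC.
  rewrite (_ : m.+1 * N + N = m.+2 * N)%N; last by rewrite [RHS]mulSn addnC.
  by rewrite /V /Y /d /= => ->; rewrite -!addrA.
have Y0 m : (0 < m)%N -> 0 <= Y m.
  case: m => // m _.
  have mN : (2 <= m.+1 * N)%N by rewrite mulSn; lia.
  rewrite /Y; apply: addr_ge0; first apply: addr_ge0.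
  - rewrite mulr_ge0 // big_nat_cond sumr_ge0 // => n; rewrite andbT => /andP[n1 nN].
    rewrite mulr_ge0 ?fourier_sq_ge0 // subr_ge0.
    have := @odd_convex b (m.+1 * N) (N - n) d3 ltac:(rewrite mulSn; lia).
    rewrite /d (_ : m.+1 * N - (N - n) = m * N + n)%N; last by rewrite mulSn; lia.
    by rewrite (_ : m.+1 * N + (N - n) = m.+2 * N - n)%N; last by rewrite !mulSn; lia.
  - rewrite mulr_ge0 //; last first.
      have -> : N%:R ^+ 2 * sq_mass - N%:R = N%:R * (N%:R * sq_mass - 1) by ring.
      by rewrite mulr_ge0.
    have := d1 (m.+1 * N).-1 ltac:(lia); have := d1 (m.+1 * N)%N ltac:(lia).
    rewrite /diff /d prednK; last by lia.
    lra.
  - rewrite mulr_ge0 // pair_sum_ge0 // => l l'; apply: kernel_ge0 => n n0.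
    by apply: d4; lia.
have V_0 : V 0%N = b 0%N + 2 * \sum_(1 <= k < T.+1) b k * a k.
  by rewrite /V mul0n pair_sum_cos_tail; under eq_bigr do rewrite add0n.
have V_big m : (T < m)%N -> V m = 0.
  move=> Tm; have Tm' : (T < m * N)%N by rewrite (leq_trans Tm) // leq_pmulr //; lia.
  rewrite /V pair_sum_cos_tail b0 // add0r big1 ?mulr0 // => n _.
  by rewrite b0 ?mul0r //; lia.
have := sum_diff2 V T.+1; rewrite (V_big T.+1) // (V_big T.+2) // !mulr0 subr0 addr0 V_0 => S1.
have := sum_mul_diff (fun m => b (m * N)%N) T.+1 => /=.
rewrite (b0 (T.+1 * N)%N) ?(b0 (T.+2 * N)%N); [|rewrite !mulSn; nia|nia].
rewrite !mulr0 !subr0 mul0n => S2.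
have S2' : \sum_(1 <= m < T.+2) b (m * N)%N = \sum_(1 <= m < T.+1) b (m * N)%N.
  by rewrite big_nat_recr //= b0 ?addr0 //; nia.
have S3 : \sum_(1 <= m < T.+2) m%:R * (V m.-1 - 2 * V m + V m.+1) =
   \sum_(1 <= m < T.+2) m%:R * (b (m.-1 * N)%N - b (m.+1 * N)%N) +
   \sum_(1 <= m < T.+2) m%:R * Y m.
  by rewrite -big_split; apply: eq_big_nat => m /andP[m1 _] /=; rewrite VE // mulrDr.
(* The remainders with m > 1 are nonnegative and are dropped. *)
have S4 : Y 1%N <= \sum_(1 <= m < T.+2) m%:R * Y m.
  rewrite big_ltn // mul1r lerDl big_nat_cond sumr_ge0 // => m.
  by rewrite andbT => /andP[m1 _]; rewrite mulr_ge0 // Y0 //; lia.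
have S5 : 2 * gap_energy N T' b <= Y 1%N.
  rewrite /gap_energy /Y /d /= !mul1n !mul0n (_ : 2 * N = N + N)%N ?mul2n ?addnn //.
  have : pair_sum mu (kernel N T' (fun n => diff4 b (N + n - 2)%N)) <=
         pair_sum mu (kernel N T (fun n => diff4 b (N + n - 2)%N)).
    apply: ler_sum => l _; apply: ler_sum => l' _.
    apply: ler_wpM2l; first by rewrite mulr_ge0 // ltW // weight_gt0.
    by apply: kernel_le => // n n0; apply: d4; lia.
  under [X in _ -> _ <= 2 * X + _ + _]eq_bigr do rewrite add0n.
  lra.
move: S1 S2 S3 S4 S5; rewrite S2'; lra.
Qed.

End FiniteEnergy.

(** * Passage to sequences tending to 0 *)

Section Truncation.
Variable R : realType.
Implicit Types b v w : nat -> R.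

Lemma cvg_sum_nat (u : nat -> nat -> R) v m n :
  (forall i, (m <= i < n)%N -> u S i @[S --> \oo] --> v i) ->
  \sum_(m <= i < n) u S i @[S --> \oo] --> \sum_(m <= i < n) v i.
Proof.
move=> uv; rewrite [X in _ --> X]big_nat_cond.
under eq_fun do rewrite big_nat_cond.
apply: cvg_big => [|i]; first exact: add_continuous.
by rewrite andbT => /uv.
Qed.

Lemma ler_sum_nat_widen v m K S : (K <= S)%N ->
  (forall i, (m <= i)%N -> 0 <= v i) ->
  \sum_(m <= i < K) v i <= \sum_(m <= i < S) v i.
Proof.
move=> KS v0; have sge0 j n : (m <= j)%N -> 0 <= \sum_(j <= i < n) v i.
  move=> mj; rewrite big_nat_cond sumr_ge0 // => i; rewrite andbT => /andP[ji _].
  by apply: v0; exact: leq_trans ji.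
have [mK|Km] := leqP m K; last by rewrite [leLHS]big_geq ?sge0 // ltnW.
by rewrite [leRHS](@big_cat_nat _ _ _ K) //= lerDl sge0.
Qed.

Lemma cvgn_le v (l c : R) : v n @[n --> \oo] --> l ->
  (\forall n \near \oo, v n <= c) -> l <= c.
Proof. exact: cvgr_to_le. Qed.

Lemma cvgn_ge_near v (l c : R) : v n @[n --> \oo] --> l -> c < l ->
  \forall n \near \oo, c <= v n.
Proof. by move=> vl cl; apply: cvgr_ge vl _ cl. Qed.

Lemma cvgn0_le v (e : R) k : v n @[n --> \oo] --> (0 : R) -> 0 < e ->
  exists2 n, (k <= n)%N & v n <= e.
Proof.
move=> v0 e0; near \oo => n; exists n; first by near: n; exact: nbhs_infty_ge.
by near: n; apply: cvgr_le e e0.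
Unshelve. all: by end_near. Qed.

Definition tail S v k : R := \sum_(k <= i < S) v i.

Lemma tail_ge S v k : (S <= k)%N -> tail S v k = 0.
Proof. by move=> Sk; rewrite /tail big_geq. Qed.

Lemma diff_tail S v k : diff (tail S v) k = if (k < S)%N then v k else 0.
Proof.
rewrite /diff; case: ltnP => kS; last by rewrite !tail_ge ?subrr // ltnW.
by rewrite /tail big_ltn // addrK.
Qed.

Lemma diff_tail_tail S v : diff (tail S (tail S v)) = tail S v.
Proof.
by apply/funext => k; rewrite diff_tail; case: ltnP => // kS; rewrite tail_ge.
Qed.

Lemma diff_cvg0 v : v n @[n --> \oo] --> (0 : R) -> diff v n @[n --> \oo] --> (0 : R).
Proof.
move=> v0; rewrite -[0]subr0; apply: cvgB => //.
by rewrite (cvg_shiftS v).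
Qed.

Lemma decr_ge0 v : v n @[n --> \oo] --> (0 : R) ->
  (forall k, (0 < k)%N -> 0 <= diff v k) -> forall k, (0 < k)%N -> 0 <= v k.
Proof.
move=> v0 dv k k0; apply: cvgn_le v0 _.
near=> n; have kn : (k <= n)%N by near: n; exact: nbhs_infty_ge.
rewrite -subr_ge0 -sum_diff // big_nat_cond sumr_ge0 // => i; rewrite andbT.
by move=> /andP[ki _]; apply: dv; exact: leq_trans ki.
Unshelve. all: by end_near. Qed.

(** Undoes one application of [diff]. The tails never exceed [v k], and already their part below [T]
    tends to [v k - v T], where [v T] is small. *)
Lemma tail_cvg (u : nat -> nat -> R) v :
  (forall S i, (0 < i)%N -> 0 <= u S i <= diff v i) ->
  (forall i, (0 < i)%N -> u S i @[S --> \oo] --> diff v i) ->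
  v n @[n --> \oo] --> (0 : R) ->
  (forall S k, (0 < k)%N -> 0 <= tail S (u S) k <= v k) /\
  (forall k, (0 < k)%N -> tail S (u S) k @[S --> \oo] --> v k).
Proof.
move=> ule ucv v0.
have dv k : (0 < k)%N -> 0 <= diff v k.
  by move=> k0; have /andP[] := ule 0%N k k0; exact: le_trans.
have vge0 := decr_ge0 v0 dv.
have bnd S k : (0 < k)%N -> 0 <= tail S (u S) k <= v k.
  move=> k0; have [kS|Sk] := leqP k S; last by rewrite tail_ge ?vge0 ?lexx // ltnW.
  apply/andP; split.
    rewrite /tail big_nat_cond sumr_ge0 // => i; rewrite andbT => /andP[ki _].
    by have /andP[] := ule S i (leq_trans k0 ki).
  rewrite -[leRHS]subr0; apply: (@le_trans _ _ (v k - v S)); last first.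
    by rewrite lerD2l lerN2 vge0 //; exact: leq_trans kS.
  rewrite -sum_diff // /tail; apply: ler_sum_nat => i /andP[ki _].
  by have /andP[] := ule S i (leq_trans k0 ki).
split=> // k k0; apply/cvgrPdist_le => e e0.
have e2 : 0 < e / 2 by rewrite divr_gt0.
have [T kT vT] := cvgn0_le k v0 e2.
have sc : \sum_(k <= i < T) u S i @[S --> \oo] --> \sum_(k <= i < T) diff v i.
  by apply: cvg_sum_nat => i /andP[ki _]; apply: ucv; exact: leq_trans ki.
rewrite sum_diff // in sc.
near=> S.
have TS : (T <= S)%N by near: S; exact: nbhs_infty_ge.
have /andP[_ tv] := bnd S k k0.
rewrite ger0_norm ?subr_ge0 //.
have : v k - v T - e / 2 <= \sum_(k <= i < T) u S i.
  by near: S; apply: cvgn_ge_near sc _; lra.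
have : \sum_(k <= i < T) u S i <= tail S (u S) k.
  rewrite /tail [leRHS](@big_cat_nat _ _ _ T) //= lerDl big_nat_cond sumr_ge0 // => i.
  rewrite andbT => /andP[Ti _].
  by have /andP[] := ule S i (leq_trans k0 (leq_trans kT Ti)).
lra.
Unshelve. all: by end_near. Qed.

(* The truncation of b keeping the fourth differences of index below S. *)
Definition trunc4 S b := tail S (tail S (tail S (tail S (diff4 b)))).

Lemma diff4_trunc4 S b k :
  diff4 (trunc4 S b) k = if (k < S)%N then diff4 b k else 0.
Proof. by rewrite /trunc4 {1}/diff4 !diff_tail_tail diff_tail. Qed.

(** Cutting off [b] itself would spoil the signs of its differences near the cut. Cutting its fourth
    differences and summing back four times keeps the signs and approximates [b] from below. *)
Lemma trunc4_cvg b : b n @[n --> \oo] --> (0 : R) ->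
  (forall k, (0 < k)%N -> 0 <= diff4 b k) ->
  (forall S k, (0 < k)%N -> 0 <= trunc4 S b k <= b k) /\
  (forall k, (0 < k)%N -> trunc4 S b k @[S --> \oo] --> b k).
Proof.
move=> b0 d4.
have c1 := diff_cvg0 b0; have c2 := diff_cvg0 c1; have c3 := diff_cvg0 c2.
have [l3 e3] := @tail_cvg (fun=> diff4 b) (diff (diff (diff b)))
  (fun _ i i0 => introT andP (conj (d4 i i0) (lexx _))) (fun _ _ => cvg_cst _) c3.
have [l2 e2] := @tail_cvg _ (diff (diff b)) l3 e3 c2.
have [l1 e1] := @tail_cvg _ (diff b) l2 e2 c1.
exact: tail_cvg l1 e1 b0.
Qed.

Variable mu : atomic_prob R.
Local Notation a := (fourier_sq mu).

Lemma kernel_cvg N T (c : nat -> nat -> R) (d : nat -> R) t :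
  (forall n, (0 < n)%N -> c S n @[S --> \oo] --> d n) ->
  kernel N T (c S) t @[S --> \oo] --> kernel N T d t.
Proof.
move=> cd; apply: cvgMl_tmp; apply: cvg_sum_nat => n /andP[n0 _].
by apply: cvgMr_tmp; exact: cd.
Qed.

Lemma gap_energy_cvg N T (u : nat -> nat -> R) b : (1 < N)%N ->
  (forall k, (0 < k)%N -> u S k @[S --> \oo] --> b k) ->
  gap_energy mu N T (u S) @[S --> \oo] --> gap_energy mu N T b.
Proof.
move=> N1 ub.
have cd : u S N.-1 - u S N.+1 @[S --> \oo] --> b N.-1 - b N.+1.
  by apply: cvgB; apply: ub; lia.
apply: cvgD; first apply: cvgD.
- apply: cvg_sum_nat => n /andP[n1 nN]; apply: cvgMr_tmp.
  by apply: cvgB; [apply: cvgB; apply: ub; lia|exact: cvgMl_tmp].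
- by apply: cvgMr_tmp; exact: cvgMl_tmp.
- rewrite /pair_sum; apply: cvg_big => [|l _]; first exact: add_continuous.
  apply: cvg_big => [|l' _]; first exact: add_continuous.
  apply: cvgMl_tmp; apply: kernel_cvg => n n0.
  under eq_fun do rewrite diff4E; rewrite diff4E.
  apply: cvgD; last by apply: ub; lia.
  apply: cvgB; last by apply: cvgMl_tmp; apply: ub; lia.
  apply: cvgD; last by apply: cvgMl_tmp; apply: ub; lia.
  apply: cvgB; last by apply: cvgMl_tmp; apply: ub; lia.
  by apply: ub; lia.
Qed.

(** The finite inequality for [trunc4 S b], with [K] and [T] fixed while [S] tends to infinity; the
    truncation is at most [b], so the right side stays below [L]. *)
Lemma gap_energy_le b N K T L : (1 < N)%N -> 0 <= N%:R * sq_mass mu - 1 ->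
  b n @[n --> \oo] --> (0 : R) -> (forall k, (0 < k)%N -> 0 <= diff4 b k) ->
  (forall n, \sum_(1 <= k < n) b k * a k <= L) ->
  \sum_(1 <= m < K) b (m * N)%N + gap_energy mu N T b <= L.
Proof.
move=> N1 X0 b0 d4 bL.
have [tle tcv] := trunc4_cvg b0 d4.
apply: (@cvgn_le (fun S =>
  \sum_(1 <= m < K) trunc4 S b (m * N)%N + gap_energy mu N T (trunc4 S b))).
  apply: cvgD; last exact: gap_energy_cvg.
  by apply: cvg_sum_nat => m /andP[m1 _]; apply: tcv; nia.
near=> S.
have SK : (K + N + T <= S)%N by near: S; exact: nbhs_infty_ge.
have t0 n : (S < n)%N -> trunc4 S b n = 0 by move=> Sn; rewrite /trunc4 tail_ge // ltnW.
have t4 k : (0 < k)%N -> 0 <= diff4 (trunc4 S b) k.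
  by move=> k0; rewrite diff4_trunc4; case: ifP => // _; exact: d4.
apply: le_trans (bL S.+1).
apply: (@le_trans _ _ (\sum_(1 <= k < S.+1) trunc4 S b k * a k)); last first.
  apply: ler_sum_nat => k /andP[k1 _].
  by rewrite ler_wpM2r ?fourier_sq_ge0 //; have /andP[] := tle S k k1.
apply: le_trans (gap_energy_finite (T' := T) _ _ X0 t0 t4); last 2 first.
- by rewrite N1; lia.
- by have : (T <= S)%N by lia; exact.
rewrite lerD2r; apply: ler_sum_nat_widen; first by lia.
by move=> m m1; have /andP[] := tle S (m * N)%N ltac:(nia).
Unshelve. all: by end_near. Qed.

End Truncation.

(** * Differences of inverse powers *)

Section InversePowers.
Variable R : realType.
Implicit Types p x : R.

Definition fdiff (f : R -> R) x : R := f x - f (x + 1).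

Definition rising n p : R := \prod_(i < n) (p + i%:R).

Lemma risingS n p : rising n.+1 p = p * rising n (p + 1).
Proof.
rewrite /rising big_ord_recl addr0; congr (_ * _); apply: eq_bigr => i _.
by rewrite /= /bump leq0n natrD addrA.
Qed.

Lemma rising_gt0 n p : 0 < p -> 0 < rising n p.
Proof. by move=> p0; apply: prodr_gt0 => i _; rewrite ltr_wpDr. Qed.

Lemma is_derive_addr (f : R -> R) x (c d : R) :
  is_derive (x + c) 1 f d -> is_derive x 1 (fun y => f (y + c)) d.
Proof.
move=> fd; have := @is_derive1_comp _ f (shift c) x d 1 fd (is_derive_shift x 1 c).
by rewrite mulr1.
Qed.

Lemma is_derive_fdiff_powR n p x : 0 < x ->
  is_derive x 1 (iter n fdiff (@powR R ^~ (- p)))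
    (- (p * iter n fdiff (@powR R ^~ (- (p + 1))) x)).
Proof.
elim: n x => [|n IH] x x0 /=.
  rewrite opprD -mulNr; exact: is_derive1_powR.
have x1 : 0 < x + 1 by exact: addr_gt0.
have := is_deriveB (IH _ x0) (is_derive_addr (IH _ x1)).
by move=> D; apply: is_derive_eq D _; rewrite /fdiff; ring.
Qed.

(* The derivative of the n-th difference of x^-p is -p times the n-th
   difference of x^-(p+1), so the mean value theorem gives the next difference. *)
Lemma fdiff_powR_bounds n p x : 0 < p -> 0 < x ->
  rising n p * (x + n%:R) `^ (- (p + n%:R)) <= iter n fdiff (@powR R ^~ (- p)) x
  <= rising n p * x `^ (- (p + n%:R)).
Proof.
elim: n p x => [|n IH] p x p0 x0.
  by rewrite /rising big_ord0 !addr0 !mul1r !lexx.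
have p1 : 0 < p + 1 by exact: addr_gt0.
pose g := iter n fdiff (@powR R ^~ (- p)).
pose dg y := - (p * iter n fdiff (@powR R ^~ (- (p + 1))) y).
have gd (y : R) : 0 < y -> is_derive y 1 g (dg y) by exact: is_derive_fdiff_powR.
have xx1 : x < x + 1 by rewrite ltrDl.
have gd' y : y \in `]x, (x + 1)[%R -> is_derive y 1 g (dg y).
  by rewrite in_itv /= => /andP[xy _]; apply: gd; exact: lt_trans xy.
have gc : {within `[x, x + 1], continuous g}.
  apply: derivable_within_continuous => y; rewrite in_itv /= => /andP[xy _].
  by have [] := gd y (lt_le_trans x0 xy).
have [c] := MVT xx1 gd' gc; rewrite in_itv /= => /andP[xc cx]; rewrite addrAC subrr add0r mulr1 => E.
have c0 : 0 < c by exact: lt_trans xc.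
have -> : fdiff (iter n fdiff (@powR R ^~ (- p))) x =
    p * iter n fdiff (@powR R ^~ (- (p + 1))) c.
  by rewrite /fdiff -/g -[LHS]opprB E opprK.
rewrite risingS -!mulrA !ler_pM2l //.
have /andP[l u] := IH _ _ p1 c0.
have mono (y z : R) : 0 < y -> y <= z ->
    rising n (p + 1) * z `^ (- (p + n.+1%:R)) <= rising n (p + 1) * y `^ (- (p + n.+1%:R)).
  move=> y0 yz; rewrite ler_pM2l ?rising_gt0 // !powRN lef_pV2 ?posrE ?powR_gt0 //.
    by apply: ge0_ler_powR; rewrite ?nnegrE //; have := ler0n R n.+1; lra.
  exact: lt_le_trans yz.
have Ep : p + 1 + n%:R = p + n.+1%:R by rewrite -natr1; ring.
rewrite Ep in l u; apply/andP; split.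
  by apply: le_trans l; apply: mono; have := ler0n R n; rewrite -?natr1; lra.
by apply: le_trans u _; apply: mono; lra.
Qed.

Definition inv_pow p (k : nat) : R := (k%:R `^ p)^-1.

Lemma inv_powE p k : inv_pow p k = k%:R `^ (- p).
Proof. by rewrite powRN. Qed.

Lemma diff_inv_pow p k : diff (inv_pow p) k = fdiff (@powR R ^~ (- p)) k%:R.
Proof. by rewrite /diff /fdiff !inv_powE natr1. Qed.

Lemma diff4_inv_pow p k : diff4 (inv_pow p) k = iter 4 fdiff (@powR R ^~ (- p)) k%:R.
Proof. by rewrite /diff4 /diff /= /fdiff !inv_powE !natr1. Qed.

Lemma diff4_inv_pow_gt0 p k : 0 < p -> (0 < k)%N -> 0 < diff4 (inv_pow p) k.
Proof.
move=> p0 k0; rewrite diff4_inv_pow.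
have k0' : 0 < k%:R :> R by rewrite ltr0n.
have /andP[l _] := fdiff_powR_bounds 4 p0 k0'.
by apply: lt_le_trans l; rewrite mulr_gt0 ?rising_gt0 ?powR_gt0 ?addr_gt0.
Qed.

Lemma inv_pow_ge0 p k : 0 <= inv_pow p k.
Proof. by rewrite invr_ge0 powR_ge0. Qed.

Lemma inv_pow_cvg0 p : 1 < p -> inv_pow p k @[k --> \oo] --> (0 : R).
Proof.
move=> p1; rewrite -(cvg_shiftS (inv_pow p)).
apply: (@squeeze_cvgr _ _ _ _ (cst 0) (@harmonic R)); last 2 first.
- exact: cvg_cst.
- exact: cvg_harmonic.
near=> k; rewrite /= inv_pow_ge0 lef_pV2 ?posrE ?powR_gt0 //.
by rewrite -[leLHS]powRr1 // ler_powR ?ler1n // ltW.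
Unshelve. all: by end_near. Qed.

(** For k >= 2, (p - 1) k^-p is at most the drop of x^-(p - 1) from k - 1 to k, so the sum
    telescopes: a finite integral test. *)
Lemma inv_pow_sum_le p n : 1 < p -> \sum_(1 <= k < n) inv_pow p k <= 1 + (p - 1)^-1.
Proof.
move=> p1; have r0 : 0 < p - 1 by lra.
case: n => [|[|n]].
- by rewrite big_geq // addr_ge0 // invr_ge0 ltW.
- by rewrite big_geq // addr_ge0 // invr_ge0 ltW.
rewrite big_ltn // /inv_pow powR1 /= invr1 lerD2l.
rewrite -div1r ler_pdivlMr // mulrC mulr_sumr big_add1 /=.
apply: (@le_trans _ _ (\sum_(1 <= k < n.+1) diff (inv_pow (p - 1)) k)).
  apply: ler_sum_nat => k /andP[k1 _].
  have k0' : 0 < k%:R :> R by rewrite ltr0n.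
  have /andP[l _] := fdiff_powR_bounds 1 r0 k0'.
  rewrite diff_inv_pow; apply: le_trans l.
  by rewrite /rising big_ord1 addr0 subrK natr1 powRN.
by rewrite sum_diff // /inv_pow powR1 /= invr1 lerBlDr lerDl inv_pow_ge0.
Qed.

Lemma diff4_expr (q : R) k : diff4 (GRing.exp q) k = q ^+ k * (1 - q) ^+ 4.
Proof. by rewrite diff4E !exprS; ring. Qed.

End InversePowers.

(** * Infinite series and the lattice case *)

Section Series.
Variable R : realType.
Implicit Types F : nat -> R.

(** The series is defined as a limit and is meaningful only under convergence, which the bound [c]
    guarantees; it is then the least upper bound of its partial sums. *)
Lemma series_sup F m (c : R) : (forall k, (m <= k)%N -> 0 <= F k) ->
  (forall n, \sum_(m <= k < n) F k <= c) ->
  [/\ forall n, \sum_(m <= k < n) F k <= \rsum_(m <= k <oo) F k,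
      forall d, (forall n, \sum_(m <= k < n) F k <= d) -> \rsum_(m <= k <oo) F k <= d &
      cvgn (fun n => \sum_(m <= k < n) F k)].
Proof.
move=> F0 Fc.
have nd : nondecreasing_seq (fun n => \sum_(m <= k < n) F k).
  by move=> n n' nn'; exact: ler_sum_nat_widen.
have cv : cvgn (fun n => \sum_(m <= k < n) F k).
  by apply: nondecreasing_is_cvgn => //; exists c => _ [n _ <-].
split=> // [n|d Fd]; first exact: nondecreasing_cvgn_le.
by apply: limr_le => //; near=> n; exact: Fd.
Unshelve. all: by end_near. Qed.

Lemma eq_series F G m : (forall k, (m <= k)%N -> F k = G k) ->
  \rsum_(m <= k <oo) F k = \rsum_(m <= k <oo) G k.
Proof.
move=> FG; congr (limn _); apply/funext => n.
by apply: eq_big_nat => k /andP[mk _]; exact: FG.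
Qed.

Lemma seriesS_recl F m : F m = 0 ->
  \rsum_(m <= k <oo) F k = \rsum_(m.+1 <= k <oo) F k.
Proof.
move=> Fm; congr (limn _); apply/funext => n.
have [mn|nm] := ltnP m n; first by rewrite big_ltn // Fm add0r.
by rewrite !big_geq // ltnW.
Qed.

Lemma sum_expr_le (q : R) n : 0 < q < 1 ->
  \sum_(1 <= k < n) q ^+ k <= q / (1 - q).
Proof.
move=> /andP[q0 q1]; have q1' : 0 < 1 - q by lra.
rewrite ler_pdivlMr //; case: n => [|n]; first by rewrite big_geq // mul0r ltW.
have -> : (\sum_(1 <= k < n.+1) q ^+ k) * (1 - q) = q - q ^+ n.+1.
  elim: n => [|n IH]; first by rewrite big_geq //; ring.
  by rewrite big_nat_recr //= mulrDl IH !exprS; ring.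
by rewrite gerBl exprn_ge0 // ltW.
Qed.

Lemma series_expr (q : R) : 0 < q < 1 -> \rsum_(1 <= k <oo) (q ^+ k) = q / (1 - q).
Proof.
move=> /andP[q0 q1]; have q1' : 1 - q != 0 by rewrite subr_eq0 gt_eqF.
apply: cvg_lim => //; rewrite -[X in X @ _ --> _]/(fun n => _) -cvg_shiftS /=.
have -> : (fun n => \sum_(1 <= k < n.+1) q ^+ k) = (fun n => (q - q * q ^+ n) / (1 - q)).
  apply/funext => n; apply: (mulIf q1'); rewrite divfK //.
  elim: n => [|n IH]; first by rewrite big_geq //; ring.
  by rewrite big_nat_recr //= mulrDl IH !exprS; ring.
apply: cvgMr_tmp; rewrite -[X in _ --> X]subr0 -[X in _ - X](mulr0 q).
apply: cvgB; first exact: cvg_cst.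
by apply: cvgMl_tmp; apply: cvg_expr; rewrite gtr0_norm.
Qed.

End Series.

(** * The three energies and the equality case *)

Section Lattice.
Variable R : realType.
Implicit Types b : nat -> R.
Variable mu : atomic_prob R.
Local Notation a := (fourier_sq mu).

Lemma padded_sum N (F : R -> R) : (atoms mu <= N)%N ->
  \sum_(l < N) F (padded_weight mu l) =
  \sum_(l < atoms mu) F (weight l) + (N - atoms mu)%:R * F 0.
Proof.
move=> MN; rewrite -(big_mkord xpredT (fun l => F (padded_weight mu l))).
rewrite (@big_cat_nat _ _ _ (atoms mu)) //= big_mkord; congr (_ + _).
  apply: eq_bigr => l _; rewrite /padded_weight; congr F.
  by rewrite insubT ?ltn_ord // => ?; congr weight; apply: val_inj.
rewrite (eq_big_nat _ _ (F2 := fun=> F 0)).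
  by rewrite big_const_nat iter_addr_0 mulr_natl.
by move=> l /andP[Ml _]; rewrite /padded_weight insubF // ltnNge Ml.
Qed.

(** The atoms and the appended zeros each contribute N^-2 to the constant term, N^-1 in total,
    against -2 N^-1 from the cross term: the number of atoms cancels. *)
Lemma padded_excess N : (0 < N)%N -> (atoms mu <= N)%N ->
  \sum_(l < N) (padded_weight mu l - N%:R^-1) ^+ 2 = sq_mass mu - N%:R^-1.
Proof.
move=> N0 MN; rewrite (padded_sum (fun x => (x - N%:R^-1) ^+ 2) MN) sub0r sqrrN.
have N0' : N%:R != 0 :> R by rewrite pnatr_eq0 -lt0n.
have -> : \sum_(l < atoms mu) (weight l - N%:R^-1) ^+ 2 =
    sq_mass mu - 2 * N%:R^-1 + (atoms mu)%:R * N%:R^-1 ^+ 2.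
  rewrite /sq_mass.
  transitivity (\sum_(l < atoms mu) (weight l ^+ 2 - 2 * N%:R^-1 * weight l + N%:R^-1 ^+ 2)).
    by apply: eq_bigr => l _; ring.
  by rewrite big_split sumrB /= -mulr_sumr weight_sum1 mulr1 sumr_const card_ord -[X in _ + X]mulr_natl.
by rewrite natrB //; field.
Qed.

Lemma excess_ge0 N : (0 < N)%N -> (atoms mu <= N)%N -> 0 <= N%:R * sq_mass mu - 1.
Proof.
move=> N0 MN; have N0' : 0 < N%:R :> R by rewrite ltr0n.
have -> : N%:R * sq_mass mu - 1 = N%:R * (sq_mass mu - N%:R^-1).
  by rewrite mulrBr divff // gt_eqF.
apply: mulr_ge0; first exact: ltW.
by rewrite -padded_excess //; apply: sumr_ge0 => l _; exact: sqr_ge0.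
Qed.

Definition monotone4 b := b n @[n --> \oo] --> (0 : R) /\
  forall k, (0 < k)%N -> 0 < diff4 b k.

Lemma decr_gt0 v : v n @[n --> \oo] --> (0 : R) ->
  (forall k, (0 < k)%N -> 0 < diff v k) -> forall k, (0 < k)%N -> 0 < v k.
Proof.
move=> v0 dv k k0; rewrite -(subrK (v k.+1) (v k)) ltr_pwDl ?dv //.
by apply: decr_ge0 => // j j0; exact/ltW/dv.
Qed.

Lemma monotone4_diff3 b : monotone4 b -> forall k, (0 < k)%N -> 0 < diff (diff (diff b)) k.
Proof. by move=> [b0 d4]; apply: decr_gt0 => //; do 3 apply: diff_cvg0. Qed.

Lemma monotone4_diff b : monotone4 b -> forall k, (0 < k)%N -> 0 < diff b k.
Proof.
move=> mb; have [b0 _] := mb; apply: decr_gt0; first exact: diff_cvg0.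
apply: decr_gt0; first by do 2 apply: diff_cvg0.
exact: monotone4_diff3.
Qed.

Lemma monotone4_gt0 b : monotone4 b -> forall k, (0 < k)%N -> 0 < b k.
Proof. by move=> mb; apply: decr_gt0; [case: mb|exact: monotone4_diff]. Qed.

Definition low_energy N b : R := \sum_(1 <= n < N)
  (b n - b (N + N - n)%N - (N - n)%:R * (b N.-1 - b N.+1)) * a n.

Definition mass_energy N b : R :=
  2^-1 * (b N.-1 - b N.+1) * (N%:R ^+ 2 * sq_mass mu - N%:R).

Definition pair_energy N T b : R :=
  pair_sum mu (kernel N T (fun n => diff4 b (N + n - 2)%N)).

Lemma low_coef_ge0 N b n : monotone4 b -> (0 < n < N)%N ->
  0 <= b n - b (N + N - n)%N - (N - n)%:R * (b N.-1 - b N.+1).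
Proof.
move=> mb /andP[n0 nN]; have d3 k k0 := ltW (@monotone4_diff3 _ mb k k0).
have := @odd_convex R b N (N - n) d3 ltac:(lia).
rewrite (_ : N - (N - n) = n)%N; last by lia.
by rewrite (_ : N + (N - n) = N + N - n)%N; [lra|lia].
Qed.

Lemma low_energy_ge0 N b : monotone4 b -> 0 <= low_energy N b.
Proof.
move=> mb; rewrite /low_energy big_nat_cond sumr_ge0 // => n; rewrite andbT => nN.
by rewrite mulr_ge0 ?fourier_sq_ge0 // low_coef_ge0.
Qed.

Lemma jump_gt0 N b : monotone4 b -> (1 < N)%N -> 0 < b N.-1 - b N.+1.
Proof.
move=> mb N1; have := monotone4_diff mb (_ : 0 < N.-1)%N.
have := monotone4_diff mb (_ : 0 < N)%N; rewrite /diff prednK; last by lia.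
by move=> /(_ ltac:(lia)) + /(_ ltac:(lia)); lra.
Qed.

Lemma mass_energy_ge0 N b : monotone4 b -> (1 < N)%N -> (atoms mu <= N)%N ->
  0 <= mass_energy N b.
Proof.
move=> mb N1 MN; apply: mulr_ge0; first by have := jump_gt0 mb N1; lra.
have -> : N%:R ^+ 2 * sq_mass mu - N%:R = N%:R * (N%:R * sq_mass mu - 1) by ring.
by rewrite mulr_ge0 // excess_ge0 //; lia.
Qed.

Lemma pair_energy_ge0 N T b : monotone4 b -> (1 < N)%N -> 0 <= pair_energy N T b.
Proof.
move=> [_ d4] N1; apply: pair_sum_ge0 => l l'; apply: kernel_ge0 => n n0.
by apply/ltW/d4; lia.
Qed.

Lemma series_energy_ge N T b c : monotone4 b -> (1 < N)%N -> (atoms mu <= N)%N ->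
  (forall n, \sum_(1 <= k < n) b k <= c) ->
  \rsum_(1 <= m <oo) b (m * N)%N +
    (low_energy N b + mass_energy N b + pair_energy N T b)
  <= \rsum_(1 <= k <oo) (b k * a k).
Proof.
move=> mb N1 MN bc; have [b0 d4] := mb; have b_gt0 := monotone4_gt0 mb.
have ba0 k : (0 < k)%N -> 0 <= b k * a k.
  by move=> k0; rewrite mulr_ge0 ?fourier_sq_ge0 // ltW ?b_gt0.
have bac n : \sum_(1 <= k < n) b k * a k <= c.
  apply: le_trans (bc n); apply: ler_sum_nat => k /andP[k1 _].
  by rewrite ler_piMr ?fourier_sq_le1 // ltW ?b_gt0.
have [baL _ _] := series_sup ba0 bac.
have d4' k k0 := ltW (d4 k k0).
have key K := @gap_energy_le R mu b N K T _ N1 (excess_ge0 (ltnW N1) MN) b0 d4' baL.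
rewrite -lerBrDr; have bN0 m : (0 < m)%N -> 0 <= b (m * N)%N.
  by move=> m0; apply/ltW/b_gt0; nia.
have bNle K : \sum_(1 <= m < K) b (m * N)%N <= \rsum_(1 <= k <oo) (b k * a k) -
    (low_energy N b + mass_energy N b + pair_energy N T b).
  by rewrite lerBrDr; exact: key.
by have [_ M2 _] := series_sup bN0 bNle; apply: M2.
Qed.

(** The equality case without a base point: all node differences are multiples of 2 pi / N. *)
Definition lattice_like N := [/\ atoms mu = N,
  forall l : 'I_(atoms mu), weight l = N%:R^-1 &
  forall l l' : 'I_(atoms mu), cos (N%:R * (node l - node l')) = 1].

(** Zero variance forces [N] equal weights. For [T = 1] the kernel is, off the diagonal, a positive
    multiple of F, so F vanishes there, which means cos (N t) = 1. *)
Lemma energy0_lattice N b : monotone4 b -> (1 < N)%N -> (atoms mu <= N)%N ->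
  low_energy N b + mass_energy N b + pair_energy N 1 b <= 0 -> lattice_like N.
Proof.
move=> mb N1 MN E0; have [b0 d4] := mb.
have N0 : 0 < N%:R :> R by rewrite ltr0n; lia.
have := low_energy_ge0 N mb; have := mass_energy_ge0 mb N1 MN.
have := pair_energy_ge0 1 mb N1 => p0 m0 l0.
have mE : mass_energy N b = 0 by lra.
have pE : pair_energy N 1 b = 0 by lra.
have X0 : sq_mass mu - N%:R^-1 = 0.
  have : mass_energy N b = 2^-1 * (b N.-1 - b N.+1) * N%:R ^+ 2 * (sq_mass mu - N%:R^-1).
    by rewrite /mass_energy; field; rewrite gt_eqF.
  rewrite mE => /esym/eqP; rewrite mulf_eq0 gt_eqF; first by move/eqP.
  by rewrite !mulr_gt0 ?invr_gt0 ?exprn_gt0 //; exact: jump_gt0.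
have pw (l : 'I_N) : padded_weight mu l = N%:R^-1.
  move: X0; rewrite -(padded_excess (ltnW N1) MN) => /eqP.
  rewrite psumr_eq0 => [/allP/(_ l)|i _]; last exact: sqr_ge0.
  by rewrite mem_index_enum sqrf_eq0 subr_eq0 => /(_ isT)/eqP.
have MNE : atoms mu = N.
  apply/eqP; rewrite eqn_leq MN leqNgt /=; apply/negP => MltN.
  have := pw (Ordinal MltN); rewrite /padded_weight insubF ?ltnn //=.
  by move/esym/eqP; rewrite invr_eq0 gt_eqF.
split=> // [l|l l'].
  have lN : (l < N)%N by apply: leq_trans MN.
  rewrite -(pw (Ordinal lN)) /padded_weight insubT ?ltn_ord //= => lM.
  by congr weight; apply: val_inj.
have [->|ll'] := eqVneq l l'; first by rewrite subrr mulr0 cos0.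
have c1 := cos_node_lt1 ll'; set t := node l - node l' in c1 *.
have k0 (i j : 'I_(atoms mu)) :
    0 <= kernel N 1 (fun n => diff4 b (N + n - 2)%N) (node i - node j).
  by apply: kernel_ge0 => n n0; apply/ltW/d4; lia.
have w0 (i j : 'I_(atoms mu)) : 0 < weight i * weight j :> R.
  by rewrite mulr_gt0 ?weight_gt0.
have : kernel N 1 (fun n => diff4 b (N + n - 2)%N) t = 0.
  move/eqP: pE; rewrite /pair_energy /pair_sum psumr_eq0 => [/allP/(_ l)|i _]; last first.
    by apply: sumr_ge0 => j _; rewrite mulr_ge0 // ltW.
  rewrite mem_index_enum => /(_ isT)/=; rewrite psumr_eq0 => [/allP/(_ l')|j _]; last first.
    by rewrite mulr_ge0 // ltW.
  by rewrite mem_index_enum mulf_eq0 gt_eqF //= => /(_ isT)/eqP.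
rewrite /kernel big_nat1 mul1r => /eqP; rewrite !mulf_eq0 invr_eq0.
have s0 : 2 - 2 * cos t != 0 by rewrite gt_eqF //; lra.
have D0 : diff4 b (N + 1 - 2)%N != 0 by rewrite gt_eqF // d4 //; lia.
have c0 : 1 - cos t != 0 by rewrite gt_eqF //; lra.
rewrite (negbTE s0) (negbTE D0) (negbTE c0) !orbF => /eqP F0.
by have := fejerE N t; rewrite F0 mulr0; lra.
Qed.

(** Only the diagonal contributes to the mean of F, which is therefore N^2 / N = N. Comparison with
    its expansion kills a k for 0 < k < N; the other values follow from N-periodicity. *)
Lemma lattice_fourier N : (1 < N)%N -> lattice_like N ->
  forall k, a k = (N %| k)%:R.
Proof.
move=> N1 [MN wN cN].
have N0 : N%:R != 0 :> R by rewrite pnatr_eq0; lia.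
have sqm : sq_mass mu = N%:R^-1.
  rewrite /sq_mass (eq_bigr (fun=> N%:R^-1 ^+ 2)) => [|l _]; last by rewrite wN.
  by rewrite sumr_const card_ord MN -mulr_natr; field.
have F0 : pair_sum mu (fejer N) = N%:R.
  rewrite pair_sum_diag; first by rewrite fejer0 sqm expr2 mulfK.
  move=> l l' ll'; have c1 := cos_node_lt1 ll'.
  have := fejerE N (node l - node l'); rewrite cN mulr1 subrr => /eqP.
  by rewrite mulf_eq0 => /orP[/eqP|/eqP//]; lra.
have small k : (0 < k < N)%N -> a k = 0.
  move=> kN; apply/eqP; rewrite eq_le fourier_sq_ge0 andbT.
  move: F0; rewrite pair_sum_fejer => /(canRL (addKr _)); rewrite addNr => F0.
  have S0 : \sum_(1 <= j < N) (N - j)%:R * a j = 0 by lra.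
  have : (N - k)%:R * a k <= \sum_(1 <= j < N) (N - j)%:R * a j.
    rewrite (bigD1_seq k) /= ?iota_uniq ?mem_index_iota // lerDl sumr_ge0 // => j _.
    by rewrite mulr_ge0 ?fourier_sq_ge0.
  by rewrite S0 pmulr_rle0 // ltr0n; lia.
have per k : a (k + N)%N = a k.
  rewrite -!pair_sum_cos; apply: eq_pair_sum => l l'.
  have /cos_eq1[z] := cN l l'; rewrite add0r => E.
  by rewrite natrD mulrDl E cos_periodicz.
have a0 : a 0%N = 1.
  rewrite -pair_sum_cos -(pair_sum_cst mu 1); apply: eq_pair_sum => l l'.
  by rewrite mul0r cos0.
have peri j k : a (j * N + k)%N = a k.
  by elim: j => [|j IH]; rewrite ?add0n // mulSn -addnA addnC per.
move=> k; rewrite {1}(divn_eq k N) peri /dvdn.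
have := ltn_pmod k (ltnW N1); case: (k %% N)%N => [|j] jN; first by rewrite a0.
by rewrite small.
Qed.

Lemma sum_multiples b N K : (0 < N)%N ->
  \sum_(1 <= k < (K * N).+1) b k * (N %| k)%:R = \sum_(1 <= m < K.+1) b (m * N)%N.
Proof.
move=> N0; elim: K => [|K IH]; first by rewrite !big_geq.
rewrite (@big_cat_nat _ _ _ (K * N).+1) //=; last by rewrite mulSn; lia.
rewrite IH [RHS]big_nat_recr //=; congr (_ + _).
rewrite mulSn addnC big_nat_recr /=; last by lia.
rewrite big_nat_cond big1 => [|k]; last first.
  rewrite andbT => /andP[k1 k2]; rewrite (_ : (N %| k)%N = false) ?mulr0 //.
  apply/negP => /dvdnP[j kj]; move: k1 k2.
  by rewrite kj addnC -mulSn !ltn_pmul2r //; lia.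
by rewrite add0r dvdn_addr ?dvdn_mull // dvdnn mulr1.
Qed.

(** Both series are suprema of partial sums, and these agree at the cuts K N. *)
Lemma lattice_series N b c : monotone4 b -> (1 < N)%N -> lattice_like N ->
  (forall n, \sum_(1 <= k < n) b k <= c) ->
  \rsum_(1 <= k <oo) (b k * a k) = \rsum_(1 <= m <oo) b (m * N)%N.
Proof.
move=> mb N1 lat bc; have b_gt0 := monotone4_gt0 mb.
have ba0 k : (0 < k)%N -> 0 <= b k * a k.
  by move=> k0; rewrite mulr_ge0 ?fourier_sq_ge0 // ltW ?b_gt0.
have bac n : \sum_(1 <= k < n) b k * a k <= c.
  apply: le_trans (bc n); apply: ler_sum_nat => k /andP[k1 _].
  by rewrite ler_piMr ?fourier_sq_le1 // ltW ?b_gt0.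
have E K : \sum_(1 <= k < (K * N).+1) b k * a k = \sum_(1 <= m < K.+1) b (m * N)%N.
  rewrite -sum_multiples; last by lia.
  by apply: eq_bigr => k _; rewrite (lattice_fourier N1 lat).
have bN0 m : (0 < m)%N -> 0 <= b (m * N)%N.
  by move=> m0; apply/ltW/b_gt0; nia.
have bNc K : \sum_(1 <= m < K) b (m * N)%N <= c.
  apply: (@le_trans _ _ (\sum_(1 <= m < K.+1) b (m * N)%N)).
    exact: ler_sum_nat_widen.
  by rewrite -E.
have [L1 L2 _] := series_sup ba0 bac; have [M1 M2 _] := series_sup bN0 bNc.
apply/le_anti/andP; split.
  apply: L2 => n; apply: le_trans (M1 n.+1); rewrite -E.
  by apply: ler_sum_nat_widen => //; nia.
apply: M2 => n; apply: le_trans (L1 (n * N).+1); rewrite E.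
exact: ler_sum_nat_widen.
Qed.

Lemma series_energy_eq N b c : monotone4 b -> (1 < N)%N -> (atoms mu <= N)%N ->
  (forall n, \sum_(1 <= k < n) b k <= c) ->
  \rsum_(1 <= k <oo) (b k * a k) = \rsum_(1 <= m <oo) b (m * N)%N <-> lattice_like N.
Proof.
move=> mb N1 MN bc; split=> [E|lat]; last exact: lattice_series bc.
apply: (energy0_lattice mb N1 MN).
by have := series_energy_ge 1 mb N1 MN bc; rewrite E gerDl.
Qed.

End Lattice.

(** * Lattice measures on the circle *)

Section LatticeMeasure.
Variables (R : realType) (mu : atomic_prob R).

Lemma dirac_sumE M (w th : 'I_M -> R) (A : set R) :
  dirac_sum w th A = (\sum_(l < M) w l * (th l \in A)%:R)%:E.
Proof. by rewrite /dirac_sum -sumEFin; apply: eq_bigr => l _; rewrite diracE. Qed.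

Lemma cos1B (x y : R) : cos x = 1 -> cos y = 1 -> cos (x - y) = 1.
Proof.
move=> cx cy; rewrite cosB cx cy mul1r.
by rewrite [sin x]cos1sin0 ?mul0r ?addr0 // cx normr1.
Qed.

Lemma cos_int_2pi (z : int) : cos (z%:~R * (2 * pi)) = 1 :> R.
Proof. by rewrite -[X in cos X]add0r cos_periodicz cos0. Qed.

(** The coset p + 2 pi Z, a periodic Borel set that stands for a single point of the circle. *)
Definition fiber (p : R) : set R := [set x | cos (x - p) = 1].

Lemma fiber_measurable p : measurable (fiber p).
Proof.
have mf : measurable_fun setT (fun x : R => cos (x - p)).
  apply: measurable_realfun.continuous_measurable_fun => x.
  apply: (@continuous_comp _ _ _ (fun x => x - p) cos); last exact: continuous_cos.
  by apply: cvgB; [exact: cvg_id|exact: cvg_cst].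
have := mf measurableT _ (measurable_set1 1).
by rewrite setTI.
Qed.

Lemma fiber_periodic p x : fiber p (x + 2 * pi) <-> fiber p x.
Proof.
rewrite /fiber /= addrAC -[2 * pi]mul1r -[1]/(1%:~R : R).
by rewrite -[1%:~R * _ in X in X <-> _]/(_ * _) (cos_periodicz (x - p) 1).
Qed.

Definition lattice_node N (g : R) (j : 'I_N) : R := g + 2 * pi * j%:R / N%:R.

Lemma lattice_node_inj N g (i j : 'I_N) :
  cos (lattice_node g i - lattice_node g j) = 1 -> i = j.
Proof.
have N0 : N%:R != 0 :> R by rewrite pnatr_eq0; have := ltn_ord i; lia.
have p0 := @pi_gt0 R.
move=> /cos_eq1[z]; rewrite add0r /lattice_node => E.
have : i%:R - j%:R = z%:~R * N%:R :> R.
  apply: (mulfI (_ : 2 * pi / N%:R != 0)); first by rewrite !mulf_neq0 ?invr_neq0 // gt_eqF //.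
  transitivity (g + 2 * pi * i%:R / N%:R - (g + 2 * pi * j%:R / N%:R)); first by ring.
  by rewrite E; field.
rewrite !pmulrn -intrM -intrB => /intr_inj zE.
have [iN jN] := (ltn_ord i, ltn_ord j); apply: val_inj => /=.
have [z0|z0|z0] := ltgtP z 0.
- have : (z + 1) * N <= 0 by rewrite mulr_le0_ge0 //; lia.
  by lia.
- have : 0 <= (z - 1) * N by rewrite mulr_ge0 //; lia.
  by lia.
- by move: zE; rewrite z0; lia.
Qed.

(** Tested on [fiber], each of the N lattice points has mass 1 / N and lies under at most one node,
    hence under exactly one, of weight 1 / N. As [atoms mu <= N], these atoms exhaust [mu]. *)
Lemma lattice_of_measure N : (0 < N)%N -> (atoms mu <= N)%N ->
  (exists g, eq_circle_measure (circle_measure mu) (lattice_measure N g)) ->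
  lattice_like mu N.
Proof.
move=> N0 MN [g E].
have N0' : N%:R != 0 :> R by rewrite pnatr_eq0 -lt0n.
pose psi := @lattice_node N g.
have mass (j : 'I_N) : \sum_(l < atoms mu) weight l * (node l \in fiber (psi j))%:R = N%:R^-1 :> R.
  have := E _ (fiber_measurable (psi j)) (fiber_periodic (psi j)).
  rewrite /circle_measure /lattice_measure !dirac_sumE => -[->].
  rewrite (bigD1 j) //= big1 => [|i ij].
    by rewrite mem_set ?mulr1 ?addr0 // /fiber /= subrr cos0.
  rewrite memNset ?mulr0 // => /lattice_node_inj ijE.
  by rewrite ijE eqxx in ij.
have ex (j : 'I_N) : exists l : 'I_(atoms mu),
    cos (node l - psi j) = 1 /\ weight l = N%:R^-1.
  have [[l cl]|none] := pselect (exists l : 'I_(atoms mu), cos (node l - psi j) = 1).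
    exists l; split=> //; rewrite -(mass j) (bigD1 l) //= big1 => [|l' ll'].
      by rewrite mem_set ?mulr1 ?addr0.
    rewrite memNset ?mulr0 // => cl'; move: (cos_node_lt1 ll').
    by rewrite -[node l' - _](subrKA (psi j)) -[psi j - _]opprB cos1B // ltxx.
  have := mass j; rewrite big1 => [/esym/eqP|l _]; first by rewrite invr_eq0 (negbTE N0').
  by rewrite memNset ?mulr0 // => cl; apply: none; exists l.
have [f fP] := choice ex.
have f_inj : injective f.
  move=> i j fij; apply: (@lattice_node_inj N g).
  have [ci _] := fP i; have [cj _] := fP j; rewrite -fij in cj.
  by rewrite -(cos1B cj ci); congr cos; rewrite /psi; ring.
have NM : (N <= atoms mu)%N by have := leq_card f f_inj; rewrite !card_ord.
have MNE : atoms mu = N by apply/eqP; rewrite eqn_leq MN.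
have f_surj l : exists j, f j = l.
  have := @inj_card_onto _ _ f f_inj; rewrite !card_ord => /(_ MN l)/codomP[j ->].
  by exists j.
split=> // [l|l l']; first by have [j <-] := f_surj l; have [] := fP j.
have [i <-] := f_surj l; have [j <-] := f_surj l'.
have [/cos_eq1[z zE] _] := fP i; have [/cos_eq1[z' zE'] _] := fP j.
rewrite add0r in zE; rewrite add0r in zE'.
transitivity (cos ((N%:Z * z - N%:Z * z' + (i%:Z - j%:Z))%:~R * (2 * pi)) : R);
  last exact: cos_int_2pi.
congr cos.
rewrite intrD !intrB !intrM -!pmulrn.
have -> := canRL (subrK _) zE; have -> := canRL (subrK _) zE'.
by rewrite /psi /lattice_node; field.
Qed.

Lemma measure_of_lattice N : (0 < N)%N -> lattice_like mu N ->
  exists g, eq_circle_measure (circle_measure mu) (lattice_measure N g).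
Proof.
move=> N0 [MN wN cN].
have N0' : N%:R != 0 :> R by rewrite pnatr_eq0 -lt0n.
have M0 : (0 < atoms mu)%N by rewrite MN.
pose l0 := Ordinal M0; pose g := node l0; exists g.
(* With N (node l - g) = 2 pi z, Euclidean division of z by N gives the lattice index and the number
   of full turns. *)
have ex (l : 'I_(atoms mu)) : exists j : 'I_N, eq_mod_2pi (node l) (lattice_node g j).
  have /cos_eq1[z] := cN l l0; rewrite add0r => zE.
  have jN : (`|(z %% N)%Z| < N)%N.
    by rewrite -ltz_nat gez0_abs ?modz_ge0 ?ltz_pmod //; lia.
  exists (Ordinal jN); exists (z %/ N)%Z; rewrite /lattice_node /=.
  have -> : (`|(z %% N)%Z|%N)%:R = (z %% N)%Z%:~R :> R.
    by rewrite pmulrn gez0_abs ?modz_ge0 //; lia.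
  apply: (mulfI N0'); rewrite -[LHS](subrK (N%:R * g)) -mulrBr zE.
  by rewrite {1}(divz_eq z N) intrD intrM -!pmulrn; field.
have [f fP] := choice ex.
have f_inj : injective f.
  move=> l l' E; apply: node_distinct; apply/eq_mod_2piP.
  have /eq_mod_2piP c := fP l; have /eq_mod_2piP c' := fP l'; rewrite -E in c'.
  by rewrite -(subrKA (lattice_node g (f l))) -[lattice_node _ _ - _]opprB cos1B.
have f_bij : bijective f by apply: inj_card_bij => //; rewrite !card_ord MN.
move=> A _ A2pi; rewrite /circle_measure /lattice_measure !dirac_sumE; congr (_%:E).
have Az (x : R) (z : int) : A (x + z%:~R * (2 * pi)) <-> A x.
  have pos (n : nat) (y : R) : A (y + n%:R * (2 * pi)) <-> A y.
    elim: n => [|n IH]; first by rewrite mul0r addr0.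
    by rewrite -natr1 mulrDl mul1r addrA A2pi.
  case: z => n; first by rewrite -pmulrn.
  rewrite NegzE mulrNz mulNr -pmulrn; rewrite -(pos n.+1 (x - _)).
  by rewrite subrK.
rewrite (reindex f) /=; last by case: f_bij => f' ff' f'f; exists f' => i _.
apply: eq_bigr => l _; rewrite wN; congr (_ * _%:R).
have [z ->] := fP l; congr (nat_of_bool _).
by apply/idP/idP; rewrite !inE => /Az.
Qed.

End LatticeMeasure.

Section PoissonAndPowers.
Variable R : realType.

Lemma monotone4_expr (q : R) : 0 < q < 1 -> monotone4 (GRing.exp q).
Proof.
move=> /andP[q0 q1]; split; first by apply: cvg_expr; rewrite gtr0_norm.
by move=> k _; rewrite diff4_expr mulr_gt0 ?exprn_gt0 // subr_gt0.
Qed.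

Lemma monotone4_inv_pow (p : R) : 1 < p -> monotone4 (inv_pow p).
Proof.
move=> p1; split; first exact: inv_pow_cvg0.
by move=> k; apply: diff4_inv_pow_gt0; lra.
Qed.

Lemma series_expr_multiples (q : R) N : (0 < N)%N -> 0 < q < 1 ->
  \rsum_(1 <= m <oo) (q ^+ (m * N)) = q ^+ N / (1 - q ^+ N).
Proof.
move=> N0 /andP[q0 q1]; rewrite -series_expr.
  by apply: eq_series => m _; rewrite mulnC exprM.
by rewrite exprn_gt0 // exprn_ilt1 // ?ltW // -lt0n.
Qed.

Lemma series_inv_pow_multiples (p : R) N : (0 < N)%N -> 1 < p ->
  \rsum_(1 <= m <oo) (inv_pow p (m * N)) = zeta p / N%:R `^ p.
Proof.
move=> N0 p1.
have [_ _ cv] := series_sup (fun k _ => inv_pow_ge0 p k) (fun n => inv_pow_sum_le n p1).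
apply: cvg_lim => //; rewrite /zeta.
have -> : (fun n => \sum_(1 <= m < n) inv_pow p (m * N)) =
    (fun n => (\sum_(1 <= m < n) (m%:R `^ p)^-1) / N%:R `^ p).
  apply/funext => n; rewrite mulr_suml; apply: eq_bigr => m _.
  by rewrite /inv_pow natrM powRM // invfM.
exact: cvgMr_tmp.
Qed.

End PoissonAndPowers.

(** * The exponent 3 *)

Section Cubes.
Variable R : realType.
Implicit Types x y : R.

Lemma odd_cubesE x y : x - y != 0 -> x + y != 0 ->
  ((x - y) ^+ 3)^-1 - ((x + y) ^+ 3)^-1 =
  y * (6 * x ^+ 2 + 2 * y ^+ 2) / (x ^+ 2 - y ^+ 2) ^+ 3.
Proof.
move=> xy xy'; rewrite subr_sqr; field.
by rewrite xy xy'.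
Qed.

Lemma jump_cubes_ge x : 1 < x ->
  6 / x ^+ 4 <= ((x - 1) ^+ 3)^-1 - ((x + 1) ^+ 3)^-1.
Proof.
move=> x1; have x0 : 0 < x by lra.
rewrite odd_cubesE ?gt_eqF //; [|lra..]; rewrite expr1n.
have s0 : 0 < x ^+ 2 - 1 by nra.
rewrite ler_pdivlMr ?exprn_gt0 // mulrAC ler_pdivrMr ?exprn_gt0 //.
have : (x ^+ 2 - 1) ^+ 3 <= x ^+ 2 ^+ 3 by rewrite lerXn2r ?nnegrE //; nra.
nra.
Qed.

Lemma odd_cubes_gap x y : 2 <= y -> y < x ->
  9 / 2 * y ^+ 3 / (x ^+ 2 - y ^+ 2) ^+ 3 <=
  (((x - y) ^+ 3)^-1 - ((x + y) ^+ 3)^-1)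
  - y * (((x - 1) ^+ 3)^-1 - ((x + 1) ^+ 3)^-1).
Proof.
move=> y2 yx; rewrite !odd_cubesE ?gt_eqF //; [|lra..].
rewrite expr1n mul1r mulr1.
(* [S] lies between [P] and [Q] because y >= 2. The gain is one factor P / S <= 1 - 3/4 y^2 / x^2;
   with E >= 6 x^2 it gives the constant 3/4 * 6 = 9/2. *)
set P := x ^+ 2 - y ^+ 2; set Q := x ^+ 2 - 1; set S := x ^+ 2 - y ^+ 2 / 4.
have P0 : 0 < P by rewrite /P; nra.
have S0 : 0 < S by rewrite /S; nra.
have PS : P <= S by rewrite /P /S; nra.
have SQ : S <= Q by rewrite /S /Q; nra.
have Q0 : 0 < Q by lra.
set E := 6 * x ^+ 2 + 2 * y ^+ 2.
have E0 : 0 < E by rewrite /E; nra.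
have qb : (6 * x ^+ 2 + 2) / Q ^+ 3 <= E / S ^+ 3.
  apply: ler_pM; [nra|by rewrite invr_ge0 exprn_ge0 // ltW|rewrite /E; nra|].
  by rewrite lef_pV2 ?posrE ?exprn_gt0 //; apply: lerXn2r; rewrite ?nnegrE; lra.
have sb : E / S ^+ 3 <= E / P ^+ 3 * (P / S).
  have -> : E / P ^+ 3 * (P / S) = E / (P ^+ 2 * S) by field; rewrite !gt_eqF.
  rewrite ler_pM2l // lef_pV2 ?posrE ?mulr_gt0 ?exprn_gt0 //.
  by rewrite (exprSr S 2) ler_pM2r //; apply: lerXn2r; rewrite ?nnegrE; lra.
have ps : P / S <= 1 - 3 / 4 * y ^+ 2 / x ^+ 2.
  have x0 : 0 < x ^+ 2 by nra.
  have -> : 1 - 3 / 4 * y ^+ 2 / x ^+ 2 = (x ^+ 2 - 3 / 4 * y ^+ 2) / x ^+ 2.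
    by field; rewrite gt_eqF //; lra.
  rewrite ler_pdivrMr // mulrAC ler_pdivlMr // /P /S; nra.
have EP0 : 0 < E / P ^+ 3 by rewrite divr_gt0 ?exprn_gt0.
have bound : (6 * x ^+ 2 + 2) / Q ^+ 3 <= E / P ^+ 3 * (1 - 3 / 4 * y ^+ 2 / x ^+ 2).
  by apply: le_trans qb _; apply: le_trans sb _; rewrite ler_pM2l.
have y0 : 0 < y by lra.
apply: (@le_trans _ _ (y * (E / P ^+ 3) * (3 / 4 * y ^+ 2 / x ^+ 2))); last first.
  rewrite -mulrA -[y * E / _]mulrA -[leRHS]mulrBr ler_pM2l //.
  move: bound; set u := E / _; set v := _ / Q ^+ 3; set w := _ / x ^+ 2; lra.
have -> : y * (E / P ^+ 3) * (3 / 4 * y ^+ 2 / x ^+ 2) =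
    (3 / 4 * y ^+ 3 / P ^+ 3) * (E / x ^+ 2).
  by field; rewrite !gt_eqF //; lra.
have -> : 9 / 2 * y ^+ 3 / P ^+ 3 = (3 / 4 * y ^+ 3 / P ^+ 3) * 6 by field; rewrite gt_eqF.
rewrite ler_pM2l; last by rewrite divr_gt0 ?mulr_gt0 ?exprn_gt0.
rewrite ler_pdivlMr /E; nra.
Qed.

Lemma inv_pow3E k : inv_pow (3 : R) k = (k%:R ^+ 3)^-1.
Proof. by rewrite /inv_pow powR_mulrn. Qed.

Variable mu : atomic_prob R.
Local Notation a := (fourier_sq mu).
Local Notation b3 := (inv_pow (3 : R)).

Lemma b3_jump N : (1 < N)%N ->
  b3 N.-1 - b3 N.+1 = ((N%:R - 1) ^+ 3)^-1 - ((N%:R + 1) ^+ 3)^-1.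
Proof.
move=> N1; rewrite !inv_pow3E -(natr1 N) -subn1 natrB //; exact: ltnW.
Qed.

Lemma low_coefE N n : (0 < n < N)%N ->
  b3 n - b3 (N + N - n)%N - (N - n)%:R * (b3 N.-1 - b3 N.+1) =
  (((N%:R - (N - n)%:R) ^+ 3)^-1 - ((N%:R + (N - n)%:R) ^+ 3)^-1)
  - (N - n)%:R * (((N%:R - 1) ^+ 3)^-1 - ((N%:R + 1) ^+ 3)^-1).
Proof.
move=> nN; rewrite b3_jump; last by lia.
rewrite !inv_pow3E -natrD -natrB; last by lia.
by congr ((_%:R ^+ 3)^-1 - (_%:R ^+ 3)^-1 - _); lia.
Qed.

Lemma defect_ge N T : (1 < N)%N -> (atoms mu <= N)%N -> fourier mu 1 = 0 ->
  low_energy mu N b3 + mass_energy mu N b3 + pair_energy mu N T b3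
  <= defect 3 N mu.
Proof.
move=> N1 MN f1; have p3 : 1 < 3 :> R by lra.
have := series_energy_ge T (monotone4_inv_pow p3) N1 MN (fun n => inv_pow_sum_le n p3).
rewrite series_inv_pow_multiples //; last exact: ltnW.
rewrite seriesS_recl ?fourier_sq0 ?mulr0 // /defect.
rewrite (@eq_series _ (fun k => inv_pow 3 k * a k) (fun k => a k / k%:R `^ 3)).
  by lra.
by move=> k _; rewrite mulrC.
Qed.

Section Energies.
Variable N : nat.
Hypotheses (N1 : (1 < N)%N) (MN : (atoms mu <= N)%N) (f1 : fourier mu 1 = 0).

Let mb : monotone4 b3 := monotone4_inv_pow (ltr1n R 3).

Lemma low_le_defect : low_energy mu N b3 <= defect 3 N mu.
Proof.
have := defect_ge 1 N1 MN f1; have := mass_energy_ge0 mb N1 MN.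
by have := pair_energy_ge0 mu 1 mb N1; lra.
Qed.

Lemma pair_le_defect T : pair_energy mu N T b3 <= defect 3 N mu.
Proof.
have := defect_ge T N1 MN f1; have := mass_energy_ge0 mb N1 MN.
by have := low_energy_ge0 mu N mb; lra.
Qed.

Lemma defect_ge0 : 0 <= defect 3 N mu.
Proof. exact: le_trans (low_energy_ge0 mu N mb) low_le_defect. Qed.

(** Half the jump of b is at least 3 N^-4, and the mass energy multiplies it by N^2 times the
    excess: hence the factor N^2 / 3. *)
Lemma excess_le_defect :
  \sum_(l < N) (padded_weight mu l - N%:R^-1) ^+ 2 <= N%:R ^+ 2 / 3 * defect 3 N mu.
Proof.
have N0 : 0 < N%:R :> R by rewrite ltr0n; lia.
rewrite padded_excess //; last exact: ltnW.
have mD : mass_energy mu N b3 <= defect 3 N mu.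
  have := defect_ge 1 N1 MN f1; have := low_energy_ge0 mu N mb.
  by have := pair_energy_ge0 mu 1 mb N1; lra.
rewrite mulrAC ler_pdivlMr // -ler_pdivrMl ?exprn_gt0 //; apply: le_trans mD.
have -> : mass_energy mu N b3 =
    2^-1 * (b3 N.-1 - b3 N.+1) * N%:R ^+ 2 * (sq_mass mu - N%:R^-1).
  by rewrite /mass_energy; field; rewrite gt_eqF.
have X0 : 0 <= sq_mass mu - N%:R^-1.
  by rewrite -padded_excess ?(ltnW N1) //; apply: sumr_ge0 => l _; exact: sqr_ge0.
have -> : (N%:R ^+ 2)^-1 * ((sq_mass mu - N%:R^-1) * 3) =
    2^-1 * (6 / N%:R ^+ 4) * N%:R ^+ 2 * (sq_mass mu - N%:R^-1).
  by field; rewrite gt_eqF.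
rewrite ler_wpM2r // ler_wpM2r ?exprn_ge0 // ler_wpM2l ?invr_ge0 // b3_jump //.
by apply: jump_cubes_ge; rewrite ltr1n.
Qed.

Lemma low_sum_le K (kappa : R) : (K <= N)%N ->
  (forall n, (1 < n < K)%N -> kappa / n%:R ^+ 3 <=
     b3 n - b3 (N + N - n)%N - (N - n)%:R * (b3 N.-1 - b3 N.+1)) ->
  kappa * (\sum_(2 <= n < K) a n / n%:R ^+ 3) <= defect 3 N mu.
Proof.
move=> KN kb; apply: le_trans low_le_defect.
have t0 n : (0 < n < N)%N -> 0 <=
    (b3 n - b3 (N + N - n)%N - (N - n)%:R * (b3 N.-1 - b3 N.+1)) * a n.
  by move=> nN; rewrite mulr_ge0 ?fourier_sq_ge0 // low_coef_ge0.
rewrite /low_energy [leRHS]big_ltn // ler_wpDl ?t0 ?N1 //.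
have [K2|K2] := leqP 2 K; last first.
  rewrite [leLHS](_ : _ = 0); last by rewrite big_geq ?mulr0 //; lia.
  by rewrite big_nat_cond sumr_ge0 // => n; rewrite andbT => nN; apply: t0; lia.
rewrite (@big_cat_nat _ _ _ K 2 N) //= ler_wpDr //.
  by rewrite big_nat_cond sumr_ge0 // => n; rewrite andbT => nN; apply: t0; lia.
rewrite mulr_sumr; apply: ler_sum_nat => n nK.
by rewrite mulrCA mulrC ler_wpM2r ?fourier_sq_ge0 // kb.
Qed.

(** Take x = N and y = N - n in [odd_cubes_gap], so that x^2 - y^2 = n (x + y). With y >= (1 -
    alpha) N and x + y <= 2 N the constant is (9/2) / 8 = 9/16. The lower bound on (1 - alpha) N
    ensures y >= 2. *)
Lemma low_band_alpha (alpha : R) K : 0 < alpha < 1 -> 2 <= (1 - alpha) * N%:R ->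
  (forall n, (n < K)%N -> n%:R <= alpha * N%:R) ->
  9 / 16 * (1 - alpha) ^+ 3 * (\sum_(2 <= n < K) a n / n%:R ^+ 3) <= defect 3 N mu.
Proof.
move=> /andP[al0 al1] aN Kal.
have N0 : 0 < N%:R :> R by rewrite ltr0n; lia.
have nN n : (n < K)%N -> (n < N)%N by move=> /Kal nal; rewrite -(ltr_nat R); nra.
apply: low_sum_le.
  by case: K nN {Kal} => // K nN; exact: nN (ltnSn K).
move=> n /andP[n1 nK]; have nNn := nN n nK; rewrite low_coefE; last by lia.
set x : R := N%:R in aN N0 *; set y : R := (N - n)%:R.
have yE : y = x - n%:R by rewrite /y natrB // ltnW.
have nal := Kal n nK.
have n0 : 0 < n%:R :> R by rewrite ltr0n; lia.
have y2 : (1 - alpha) * x <= y by rewrite yE; lra.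
apply: le_trans (odd_cubes_gap _ _); [|lra|lra].
rewrite subr_sqr exprMn (_ : x - y = n%:R); last by rewrite yE; ring.
have xy : 0 < x + y by lra.
have -> : 9 / 2 * y ^+ 3 / (n%:R ^+ 3 * (x + y) ^+ 3) =
    9 / 2 * y ^+ 3 / (x + y) ^+ 3 / n%:R ^+ 3.
  by field; rewrite !gt_eqF.
rewrite ler_pM2r ?invr_gt0 ?exprn_gt0 //.
rewrite ler_pdivlMr ?exprn_gt0 //.
have c1 : (x + y) ^+ 3 <= (2 * x) ^+ 3 by rewrite lerXn2r ?nnegrE; lra.
have c2 : ((1 - alpha) * x) ^+ 3 <= y ^+ 3 by rewrite lerXn2r ?nnegrE //; nra.
have a3 : 0 < (1 - alpha) ^+ 3 by rewrite exprn_gt0 //; lra.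
apply: (@le_trans _ _ (9 / 16 * (1 - alpha) ^+ 3 * (2 * x) ^+ 3)).
  by rewrite ler_pM2l // mulr_gt0.
by move: c2; rewrite !exprMn; lra.
Qed.

(** [low_band_alpha] at alpha = 1/10 would lose more than 5/4. Here n^-3 is the main term, and for n
    <= N / 10 the two negative ones are below n^-3 / 10 and n^-3 / 100. *)
Lemma low_band_tenth : (20 <= N)%N ->
  \sum_(2 <= k < (N %/ 10).+1) a k / k%:R ^+ 3 <= 5 / 4 * defect 3 N mu.
Proof.
move=> N20; suff: 4 / 5 * (\sum_(2 <= k < (N %/ 10).+1) a k / k%:R ^+ 3) <= defect 3 N mu.
  by lra.
apply: low_sum_le; first by lia.
move=> n /andP[n1 nK]; rewrite low_coefE; last by lia.
set x : R := N%:R; set y : R := (N - n)%:R.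
have yE : y = x - n%:R by rewrite /y natrB //; lia.
have x20 : 20 <= x by rewrite /x (ler_nat R 20).
have n0 : 1 <= n%:R :> R by rewrite ler1n; lia.
have nx : 10 * n%:R <= x by rewrite /x -natrM ler_nat; lia.
rewrite (_ : x - y = n%:R); last by rewrite yE; ring.
have J : ((x - 1) ^+ 3)^-1 - ((x + 1) ^+ 3)^-1 <= 7 / x ^+ 4.
  rewrite odd_cubesE ?gt_eqF //; [|lra..]; rewrite expr1n mul1r mulr1.
  have s0 : 0 < x ^+ 2 - 1 by nra.
  rewrite ler_pdivrMr ?exprn_gt0 // mulrAC ler_pdivlMr ?exprn_gt0 //; last by lra.
  set z := x ^+ 2 in s0 *; have z4 : 400 <= z by rewrite /z; nra.
  have -> : x ^+ 4 = z ^+ 2 by rewrite /z -exprM.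
  nra.
have c1 : ((x + y) ^+ 3)^-1 <= 1 / 10 * (n%:R ^+ 3)^-1.
  rewrite mul1r -invfM lef_pV2 ?posrE ?mulr_gt0 ?exprn_gt0 //; [|lra..].
  have : (10 * n%:R) ^+ 3 <= (x + y) ^+ 3 by rewrite lerXn2r ?nnegrE; lra.
  have : 0 <= (n%:R : R) ^+ 3 by rewrite exprn_ge0 //; lra.
  rewrite exprMn; lra.
have c2 : y * (7 / x ^+ 4) <= 1 / 100 * (n%:R ^+ 3)^-1.
  have x0 : 0 < x by lra.
  rewrite mulrA ler_pdivrMr ?exprn_gt0 // mulrAC ler_pdivlMr ?exprn_gt0 //; last by lra.
  have : (10 * n%:R) ^+ 3 <= x ^+ 3 by rewrite lerXn2r ?nnegrE; lra.
  rewrite exprMn => h.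
  have : y * n%:R ^+ 3 <= x * n%:R ^+ 3 by rewrite ler_pM2r ?exprn_gt0 //; lra.
  rewrite (exprSr x 3); nra.
have y0 : 0 <= y by rewrite /y.
have := ler_wpM2l y0 J; set v := (n%:R ^+ 3)^-1 in c1 c2 *.
have : 0 < v by rewrite invr_gt0 exprn_gt0 //; lra.
lra.
Qed.

End Energies.
End Cubes.

(** * Gaps between neighbouring nodes *)

Section TrigBounds.
Variable R : realType.
Implicit Types x t : R.

Lemma sin_mvt (x y : R) : x < y ->
  exists2 c, x < c < y & sin y - sin x = cos c * (y - x).
Proof.
move=> xy.
have h1 z : z \in `]x, y[%R -> is_derive z 1 sin (cos z) by move=> _; exact: is_derive_sin.
have h2 : {within `[x, y], continuous (@sin R)}.
  by apply: continuous_subspaceT => z; exact: continuous_sin.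
by have [c] := MVT xy h1 h2; rewrite in_itv /=; exists c.
Qed.

Lemma sin_le_id x : 0 <= x -> sin x <= x.
Proof.
rewrite le_eqVlt => /orP[/eqP <-|x0]; first by rewrite sin0.
have [c _] := sin_mvt x0; rewrite sin0 !subr0 => ->.
by rewrite ler_piMl ?cos_le1 // ltW.
Qed.

(* By the mean value theorem on [0, x] and [x, pi/2], the slope of sin is
   larger on the left of x than on its right. *)
Lemma jordan_sin x : 0 <= x <= pi / 2 -> 2 / pi * x <= sin x.
Proof.
have p0 := @pi_gt0 R.
rewrite le_eqVlt => /andP[/orP[/eqP <-|x0]]; first by rewrite sin0 mulr0.
rewrite le_eqVlt => /orP[/eqP ->|x1].
  rewrite sin_pihalf; rewrite mulrA divfK ?divff ?gt_eqF //.
have [c /andP[c0 cx]] := sin_mvt x0; rewrite sin0 !subr0 => sx.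
have [d /andP[xd dp]] := sin_mvt x1; rewrite sin_pihalf => s1.
have cd : cos d <= cos c.
  by rewrite ltW // ltr_cos ?in_itv /=; lra.
have : (1 - sin x) * x <= sin x * (pi / 2 - x).
  have h0 : 0 <= (pi / 2 - x) * x by apply: mulr_ge0; lra.
  by have := ler_wpM2r h0 cd; rewrite s1 sx; lra.
move=> h; have {}h : x <= sin x * (pi / 2) by lra.
by rewrite mulrAC ler_pdivrMr //; lra.
Qed.

Lemma one_sub_cos x : 1 - cos x = 2 * sin (x / 2) ^+ 2.
Proof.
rewrite {1}(_ : x = (x / 2) *+ 2); last by rewrite -mulr_natr divfK.
by rewrite cos_mulr2n cos2sin2; ring.
Qed.

Lemma one_sub_cos_le x : 1 - cos x <= x ^+ 2 / 2.
Proof.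
wlog x0 : x / 0 <= x.
  move=> h; have [/h//|/ltW x0] := leP 0 x.
  by rewrite -cosN -sqrrN h // oppr_ge0.
have x2 : 0 <= x / 2 by lra.
have sx := sin_le_id x2.
rewrite one_sub_cos; have [s0|s0] := leP 0 (sin (x / 2)).
  by have : sin (x / 2) ^+ 2 <= (x / 2) ^+ 2; [rewrite lerXn2r|nra].
have s1 := sin_geN1 (x / 2).
have [x4|x4] := leP x 2; last by nra.
have p2 := @pi_ge2 R; have : 0 <= sin (x / 2) by apply: sin_ge0_pi; rewrite x2 /=; lra.
by lra.
Qed.

Lemma one_sub_cos_ge x : `|x| <= pi -> 2 / pi ^+ 2 * x ^+ 2 <= 1 - cos x.
Proof.
have p0 := @pi_gt0 R.
wlog x0 : x / 0 <= x.
  move=> h; have [/h//|/ltW x0] := leP 0 x.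
  by move=> xp; rewrite -cosN -(sqrrN x); apply: h; rewrite ?oppr_ge0 ?normrN.
rewrite ger0_norm // => xp; have x2 : 0 <= x / 2 <= pi / 2 by lra.
rewrite one_sub_cos.
have E (p : R) : 0 < p -> 2 / p ^+ 2 * x ^+ 2 = 2 * (2 / p * (x / 2)) ^+ 2.
  by move=> p0'; field; rewrite gt_eqF.
rewrite E //.
have q0 : 0 <= 2 / pi * (x / 2) by apply: mulr_ge0; [apply: divr_ge0|]; lra.
rewrite ler_pM2l // lerXn2r ?nnegrE ?jordan_sin //.
exact: le_trans (jordan_sin x2).
Qed.

Lemma sinS_rec t n :
  sin (n.+2%:R * t) = 2 * cos t * sin (n.+1%:R * t) - sin (n%:R * t).
Proof.
have -> : n.+2%:R * t = n.+1%:R * t + t by rewrite -!natr1; ring.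
have -> : n%:R * t = n.+1%:R * t - t by rewrite -!natr1; ring.
by rewrite sinD sinB; ring.
Qed.

Definition sine_kernel m (be t : R) : R :=
  2 * \sum_(1 <= k < m) sin (k%:R * be) * cos (k%:R * t).

Lemma sine_kernelS n be t : (cos t - cos be) * sine_kernel n.+1 be t =
  sin be + sin (n%:R * be) * cos (n.+1%:R * t) - sin (n.+1%:R * be) * cos (n%:R * t).
Proof.
elim: n => [|n IH].
  by rewrite /sine_kernel big_geq // !(mul0r, mul1r) sin0 cos0; ring.
rewrite /sine_kernel big_nat_recr //= mulrDr mulrDr -/(sine_kernel n.+1 be t) IH.
by rewrite sinS_rec cosS_rec; ring.
Qed.

(** For m be = pi the boundary terms collapse to 1 + cos (m t) >= 0, so for m > 1 the kernel never
    has the sign opposite to cos t - cos be. *)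
Lemma sine_kernelE m be t : (0 < m)%N -> m%:R * be = pi ->
  (cos t - cos be) * sine_kernel m be t = sin be * (1 + cos (m%:R * t)).
Proof.
case: m => // n _ mb; rewrite sine_kernelS mb sinpi mul0r subr0.
have -> : n%:R * be = pi - be by rewrite -mb -natr1; ring.
by rewrite sinB sinpi cospi; ring.
Qed.

Lemma cos_lt_outside (x be : R) : 0 <= be -> be < x < 2 * pi - be -> cos x < cos be.
Proof.
move=> b0 /andP[bx xb]; have p0 := @pi_gt0 R.
have [xp|px] := leP x pi; first by rewrite ltr_cos ?in_itv /=; lra.
have -> : cos x = cos (2 * pi - x).
  rewrite -[in LHS](opprK x) cosN -(cos_periodicz (- x) 1); congr cos; ring.
by rewrite ltr_cos ?in_itv /=; lra.
Qed.

Lemma sqr_sum_le n (x : 'I_n -> R) :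
  (\sum_i x i) ^+ 2 <= n%:R * \sum_i x i ^+ 2.
Proof.
have : 0 <= \sum_i \sum_j (x i - x j) ^+ 2.
  by apply: sumr_ge0 => i _; apply: sumr_ge0 => j _; exact: sqr_ge0.
have -> : \sum_i \sum_j (x i - x j) ^+ 2 =
    2 * (n%:R * \sum_i x i ^+ 2) - 2 * (\sum_i x i) ^+ 2; last lra.
transitivity (\sum_i (n%:R * x i ^+ 2 - 2 * x i * (\sum_j x j) + \sum_j x j ^+ 2)).
  apply: eq_bigr => i _.
  transitivity (\sum_(j < n) (x i ^+ 2 - 2 * x i * x j + x j ^+ 2)).
    by apply: eq_bigr => j _; ring.
  by rewrite big_split sumrB /= sumr_const card_ord -mulr_sumr -[X in X - _ + _]mulr_natl.
rewrite big_split sumrB /= -!mulr_sumr -mulr_suml -mulr_sumr.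
by rewrite sumr_const card_ord -mulr_natl; ring.
Qed.

End TrigBounds.

(** * Lifted nodes in cyclic order *)

Section CyclicOrder.
Variables (R : realType) (N : nat) (mu : atomic_prob R).
Variables (th : int -> R) (lab : int -> 'I_(atoms mu)).
Hypotheses (N0 : (0 < N)%N) (cyc : cyclic_order N th lab).

Lemma cyc_lt i j : i < j -> th i < th j.
Proof. by case: cyc => + _ _ _; apply. Qed.

Lemma cyc_le i j : i <= j -> th i <= th j.
Proof. by rewrite le_eqVlt => /orP[/eqP ->|/cyc_lt/ltW]. Qed.

Lemma cyc_period j (q : int) : th (j + q * N%:Z) = th j + q%:~R * (2 * pi).
Proof.
have pos (n : nat) i : th (i + n%:Z * N%:Z) = th i + n%:R * (2 * pi).
  elim: n => [|n IH]; first by rewrite !mul0r !addr0.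
  have -> : i + n.+1%:Z * N%:Z = i + n%:Z * N%:Z + N%:Z by lia.
  by case: cyc => _ -> _ _; rewrite IH -natr1; ring.
case: q => n; first exact: pos.
rewrite -[in RHS](subrK (n.+1%:Z * N%:Z) j) pos NegzE mulrNz -pmulrn.
by rewrite (_ : j - n.+1%:Z * N%:Z = j + - n.+1%:Z * N%:Z); [ring|lia].
Qed.

Lemma cyc_window (j0 : int) (l : 'I_(atoms mu)) :
  exists2 i, j0 <= i < j0 + N%:Z & eq_mod_2pi (node l) (th i).
Proof.
case: (cyc) => _ _ tl /(_ l)[j jl].
exists (j0 + ((j - j0) %% N%:Z)%Z).
  have Nz : N%:Z != 0 by lia.
  have := modz_ge0 (j - j0) Nz; have := ltz_pmod (j - j0) (_ : 0 < N%:Z).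
  by move=> /(_ ltac:(lia)); lia.
have [z zE] := tl j; rewrite jl in zE.
exists (((j - j0) %/ N%:Z)%Z - z).
have E := divz_eq (j - j0) N%:Z.
have jE : j = (j0 + ((j - j0) %% N%:Z)%Z) + ((j - j0) %/ N%:Z)%Z * N%:Z by lia.
move: zE; rewrite {1}jE cyc_period intrB => zE.
by move: zE; set u := th _; move=> zE; rewrite mulrBl; lra.
Qed.

(** Lifts of the same atom differ by a multiple of 2 pi, but within one period they are less than 2
    pi apart. *)
Lemma cyc_inj (i j : int) : 0 <= i < N%:Z -> 0 <= j < N%:Z -> lab i = lab j -> i = j.
Proof.
move=> iN jN ij; case: (cyc) => _ _ tl _.
have [z zi] := tl i; have [z' zj] := tl j; rewrite ij in zi.
have p0 := @pi_gt0 R.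
have E : th i - th j = (z - z')%:~R * (2 * pi) by rewrite zi zj intrB; ring.
have th_i : th i < th j + 2 * pi.
  by case: (cyc) => _ <- _ _; apply: cyc_lt; lia.
have th_j : th j < th i + 2 * pi.
  by case: (cyc) => _ <- _ _; apply: cyc_lt; lia.
have zz : z - z' = 0.
  have p2 : 0 < 2 * pi :> R by lra.
  have h1 : (z - z')%:~R < 1%:~R :> R by rewrite -(ltr_pM2r p2) -E; lra.
  have h2 : (- 1)%:~R < (z - z')%:~R :> R.
    by rewrite -(ltr_pM2r p2) -E (_ : (- 1)%:~R = - 1 :> R) //; lra.
  by move: h1 h2; rewrite !ltr_int; lia.
rewrite zz mul0r in E.
have [ij'|ji|//] := ltgtP i j; exfalso; [have := cyc_lt ij'|have := cyc_lt ji]; lra.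
Qed.

Lemma cyc_bij (MN : (atoms mu <= N)%N) : bijective (fun j : 'I_N => lab j).
Proof.
apply: inj_card_bij; last by rewrite !card_ord.
move=> i j /cyc_inj; have := ltn_ord i; have := ltn_ord j => iN jN.
by move=> /(_ ltac:(lia) ltac:(lia)) [] /val_inj.
Qed.

End CyclicOrder.

(** * The kernel at a short gap *)

Section PeriodicKernels.
Variable R : realType.
Implicit Types t : R.

Lemma cos_mod_2pi k t t' : eq_mod_2pi t t' -> cos (k%:R * t) = cos (k%:R * t') :> R.
Proof.
move=> [z ->]; rewrite -(cos_periodicz (k%:R * t') (k%:Z * z)); congr cos.
by rewrite intrM -pmulrn; ring.
Qed.

Lemma sine_kernel_mod m (be : R) t t' : eq_mod_2pi t t' ->
  sine_kernel m be t = sine_kernel m be t'.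
Proof.
by move=> tt'; congr (2 * _); apply: eq_bigr => k _; rewrite (cos_mod_2pi k tt').
Qed.

Lemma kernel_mod N T c t t' : eq_mod_2pi t t' -> kernel N T c t = kernel N T c t' :> R.
Proof.
move=> tt'; have c1 := cos_mod_2pi 1 tt'; rewrite !mul1r in c1.
rewrite /kernel /fejer c1; congr ((_ + 2 * _) / _ * _).
  by apply: eq_bigr => k _; rewrite (cos_mod_2pi k tt').
by apply: eq_bigr => k _; rewrite (cos_mod_2pi k tt').
Qed.

(** The zeros in range are s = 0 and s = 1. At distance |u| <= 1/2 from the nearer one, Jordan's
    inequality gives 16 u^2; the constant 7 is below 16 / (3/2)^2, as needed for s up to 3/2. *)
Lemma two_cos_gap (s : R) : 0 <= s <= 3 / 2 ->
  7 * s ^+ 2 * (1 - s) ^+ 2 <= 2 - 2 * cos (2 * pi * s).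
Proof.
move=> /andP[s0 s1]; have p0 := @pi_gt0 R.
have base (u : R) : `|u| <= 2^-1 -> 16 * u ^+ 2 <= 2 - 2 * cos (2 * pi * u).
  move=> u2; have := @one_sub_cos_ge R (2 * pi * u).
  rewrite normrM ger0_norm; last by lra.
  have : 2 * pi * `|u| <= pi by nra.
  move=> -> /(_ isT).
  have E (p : R) : 0 < p -> 2 / p ^+ 2 * (2 * p * u) ^+ 2 = 8 * u ^+ 2.
    by move=> p0'; field; rewrite gt_eqF.
  rewrite E //; lra.
have [s2|s2] := leP s 2^-1.
  have := base s; rewrite ger0_norm // => /(_ s2) b.
  apply: le_trans b; have : (1 - s) ^+ 2 <= 1 by nra.
  have := sqr_ge0 s; nra.
have -> : cos (2 * pi * s) = cos (2 * pi * (s - 1)).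
  by rewrite -(cos_periodicz (2 * pi * (s - 1)) 1); congr cos; ring.
have b := base (s - 1); apply: le_trans (b _); last by rewrite ler_norml; lra.
rewrite -(sqrrN (s - 1)) opprB; have : s ^+ 2 <= 9 / 4 by nra.
have := sqr_ge0 (1 - s); nra.
Qed.

Lemma sum_sqr_ge T : (T%:R : R) ^+ 3 / 3 <= \sum_(1 <= n < T.+1) n%:R ^+ 2.
Proof.
elim: T => [|T IH]; first by rewrite big_geq //; lra.
rewrite big_nat_recr //= -natr1; have := ler0n R T; nra.
Qed.

(** The 7 is that of [two_cos_gap]; 40^2 pi^4 is (2 pi)^2, from s = g N / (2 pi), times the 20^2
    pi^2 of the sum [S] in [kernel_gap_ge]. *)
Definition gap_weight : R := 7 / (40 ^+ 2 * pi ^+ 4).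

Lemma gap_weight_gt0 : 0 < gap_weight.
Proof. by rewrite divr_gt0 // mulr_gt0 ?exprn_gt0 // pi_gt0. Qed.

Lemma diff4_inv_pow3_ge k : (0 < k)%N ->
  36 / (k.+4%:R : R) ^+ 7 <= diff4 (inv_pow 3) k.
Proof.
move=> k0; rewrite diff4_inv_pow.
have k0' : 0 < k%:R :> R by rewrite ltr0n.
have /andP[+ _] := fdiff_powR_bounds 4 (ltr0n R 3) k0'.
apply: le_trans; rewrite -natrD -natrD addn4 powRN powR_mulrn //.
rewrite ler_wpM2r ?invr_ge0 ?exprn_ge0 //.
(* The exact factor is 3 * 4 * 5 * 6 = 360, of which 36 is kept. *)
by rewrite /rising !big_ord_recl big_ord0 /= /bump /=; lra.
Qed.

(** With s = g N / (2 pi), F is at least 7 s^2 (1 - s)^2 / g^2. The cut N / 3 keeps n g <= pi, so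
    that 1 - cos (n g) is of order (n g)^2; fourth differences of order N^-7 and a sum of n^2 of
    order N^3 make the other factor of order N^-4. *)
Lemma kernel_gap_ge N (g : R) : (12 <= N)%N -> 0 < g <= 3 * pi / N%:R ->
  gap_weight / N%:R ^+ 2 * (g * N%:R / (2 * pi) - 1) ^+ 2 <=
  kernel N (N %/ 3) (fun n => diff4 (inv_pow 3) (N + n - 2)%N) g.
Proof.
move=> N12 /andP[g0 gN]; have p0 := @pi_gt0 R.
set x : R := N%:R in gN *; have x12 : 12 <= x by rewrite /x (ler_nat R 12).
have x0 : 0 < x by lra.
have N4 : x / 4 <= (N %/ 3)%:R.
  by rewrite ler_pdivrMr // /x -natrM ler_nat; clear -N12; lia.
have gx : g * x <= 3 * pi by rewrite -ler_pdivlMr.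
have gpi : g <= pi by nra.
set s := g * x / (2 * pi).
have sE : 2 * pi * s = x * g by rewrite /s mulrC divfK 1?mulrC // gt_eqF //; lra.
have s0 : 0 <= s <= 3 / 2.
  apply/andP; split; last by rewrite ler_pdivrMr; lra.
  by apply: divr_ge0; [apply: mulr_ge0; exact: ltW|lra].
have c0 : 0 < 2 - 2 * cos g.
  have := @one_sub_cos_ge R g; rewrite ger0_norm; last exact: ltW.
  move=> /(_ gpi).
  by have : 0 < 2 / pi ^+ 2 * g ^+ 2; [rewrite mulr_gt0 ?divr_gt0 ?exprn_gt0|lra].
have cg : 2 - 2 * cos g <= g ^+ 2 by have := one_sub_cos_le g; lra.
have F := fejerE N g; rewrite -/x -sE in F.
have F7 := two_cos_gap s0; rewrite -F in F7.
have F0 : 0 <= fejer N g.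
  by rewrite -(pmulr_rge0 _ c0) F; have := cos_le1 (2 * pi * s); lra.
have Fg : 7 * s ^+ 2 * (1 - s) ^+ 2 / g ^+ 2 <= fejer N g.
  by rewrite ler_pdivrMr ?exprn_gt0 //; apply: le_trans F7 _; rewrite mulrC ler_wpM2l.
have term n : (0 < n < (N %/ 3).+1)%N ->
    9 / (16 * pi ^+ 2 * x ^+ 7) * g ^+ 2 * n%:R ^+ 2 <=
    diff4 (inv_pow 3) (N + n - 2)%N * (1 - cos (n%:R * g)).
  move=> nT; have d4 : 36 / (2 * x) ^+ 7 <= diff4 (inv_pow 3) (N + n - 2)%N.
    apply: le_trans (diff4_inv_pow3_ge _); last by clear -N12 nT; lia.
    rewrite ler_pM2l // lef_pV2 ?posrE ?exprn_gt0 //; last by lra.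
    rewrite lerXn2r ?nnegrE //; first by lra.
    by rewrite /x -natrM ler_nat; clear -N12 nT; lia.
  have n0 : 0 <= n%:R :> R by [].
  have n3 : 3 * n%:R <= x by rewrite /x -natrM ler_nat; clear -nT; lia.
  have := @one_sub_cos_ge R (n%:R * g).
  rewrite ger0_norm ?mulr_ge0 ?(ltW g0) //.
  have -> : n%:R * g <= pi by nra.
  move=> /(_ isT) cb.
  apply: (@le_trans _ _ (36 / (2 * x) ^+ 7 * (2 / pi ^+ 2 * (n%:R * g) ^+ 2))).
    have E (p : R) : 0 < p -> 9 / (16 * p ^+ 2 * x ^+ 7) * g ^+ 2 * n%:R ^+ 2 =
        36 / (2 * x) ^+ 7 * (2 / p ^+ 2 * (n%:R * g) ^+ 2).
      by move=> p0'; field; rewrite !gt_eqF.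
    by rewrite E.
  apply: ler_pM d4 cb; first by rewrite divr_ge0 ?exprn_ge0 ?mulr_ge0 ?(ltW x0).
  by rewrite mulr_ge0 ?sqr_ge0 // divr_ge0 ?exprn_ge0 // ltW.
have S : (20 ^+ 2 * pi ^+ 2 * x ^+ 4)^-1 * g ^+ 2 <=
    \sum_(1 <= n < (N %/ 3).+1) diff4 (inv_pow 3) (N + n - 2)%N * (1 - cos (n%:R * g)).
  apply: (@le_trans _ _ (\sum_(1 <= n < (N %/ 3).+1)
      9 / (16 * pi ^+ 2 * x ^+ 7) * g ^+ 2 * n%:R ^+ 2)).
    rewrite -mulr_sumr; set A := _ * g ^+ 2; set Q := \sum_(1 <= n < _) _.
    (* The sum is at least (x / 4)^3 / 3 = x^3 / 192; 225 is taken because 9 / (16 * 225) = 1 /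
       20^2. *)
    have Q1 : x ^+ 3 / 225 <= Q.
      apply: le_trans (sum_sqr_ge _); have : (x / 4) ^+ 3 <= (N %/ 3)%:R ^+ 3.
        by rewrite lerXn2r ?nnegrE //; lra.
      by rewrite expr_div_n; have := exprn_gt0 3 x0; lra.
    have A0 : 0 <= 9 / (16 * pi ^+ 2 * x ^+ 7) * g ^+ 2.
      by rewrite mulr_ge0 ?sqr_ge0 // divr_ge0 // !mulr_ge0 ?exprn_ge0 ?ltW.
    apply: le_trans (ler_wpM2l A0 Q1).
    have E (p : R) : 0 < p -> (20 ^+ 2 * p ^+ 2 * x ^+ 4)^-1 * g ^+ 2 =
        9 / (16 * p ^+ 2 * x ^+ 7) * g ^+ 2 * (x ^+ 3 / 225).
      by move=> p0'; field; rewrite !gt_eqF.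
    by rewrite /A E.
  by apply: ler_sum_nat => n; exact: term.
set Sm := \sum_(1 <= n < _) _ in S.
have S2 : (20 ^+ 2 * pi ^+ 2 * x ^+ 4)^-1 <= Sm / (2 - 2 * cos g).
  rewrite ler_pdivlMr //; apply: le_trans S; rewrite ler_wpM2l //.
  by rewrite invr_ge0 !mulr_ge0 ?exprn_ge0 ?ltW.
have -> : kernel N (N %/ 3) (fun n => diff4 (inv_pow 3) (N + n - 2)%N) g =
    fejer N g * (Sm / (2 - 2 * cos g)) by rewrite /kernel mulrAC -mulrA.
apply: le_trans (ler_pM _ _ Fg S2).
- have E (p : R) : 0 < p -> 7 / (40 ^+ 2 * p ^+ 4) / x ^+ 2 * (g * x / (2 * p) - 1) ^+ 2 =
      7 * (g * x / (2 * p)) ^+ 2 * (1 - g * x / (2 * p)) ^+ 2 / g ^+ 2 *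
      ((20 ^+ 2 * p ^+ 2 * x ^+ 4)^-1).
    by move=> p0'; field; rewrite !gt_eqF.
  by rewrite /gap_weight E.
- by rewrite divr_ge0 ?sqr_ge0 // mulr_ge0 ?sqr_ge0 // mulr_ge0 ?sqr_ge0.
- by rewrite invr_ge0 !mulr_ge0 ?exprn_ge0 ?ltW.
Qed.

End PeriodicKernels.

(** * Exclusion of wide gaps *)

Section WideGaps.
Variables (R : realType) (mu : atomic_prob R).
Local Notation a := (fourier_sq mu).

(** The left side is the squared real part of the coefficient after rotation by k om. *)
Lemma cos_moment_le k (om : R) :
  (\sum_(l < atoms mu) weight l * cos (k%:R * (node l - om))) ^+ 2 <= a k.
Proof.
rewrite fourier_sqE.
set C := \sum_(l < _) weight l * cos (k%:R * node l).
set S := \sum_(l < _) weight l * sin _.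
have -> : \sum_(l < atoms mu) weight l * cos (k%:R * (node l - om)) =
    C * cos (k%:R * om) + S * sin (k%:R * om).
  rewrite !mulr_suml -big_split; apply: eq_bigr => l _ /=.
  by rewrite mulrBr cosB; ring.
have := cos2Dsin2 (k%:R * om); set c := cos _; set s := sin _ => cs.
have := sqr_ge0 (C * s - S * c).
have -> : C ^+ 2 + S ^+ 2 = (C ^+ 2 + S ^+ 2) * (c ^+ 2 + s ^+ 2) by rewrite cs mulr1.
nra.
Qed.

(** A weight 1 / (2 N) times the depth 2 (1 - cos (pi / 4)) m / pi^2 of the test polynomial in
    [gap_lt] at the left end of the gap, with m >= N / 2. *)
Definition gap_const : R := (1 - cos (pi / 4)) / (2 * pi ^+ 2).

Lemma cos_pi4_lt1 : cos (pi / 4) < 1 :> R.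
Proof.
have p0 := @pi_gt0 R; have : cos (pi / 4) < cos 0 :> R.
  by rewrite ltr_cos ?in_itv /=; lra.
by rewrite cos0.
Qed.

Lemma gap_const_gt0 : 0 < gap_const.
Proof. by rewrite divr_gt0 ?subr_gt0 ?cos_pi4_lt1 // mulr_gt0 // exprn_gt0 // pi_gt0. Qed.

Variables (N : nat) (th : int -> R) (lab : int -> 'I_(atoms mu)).
Hypotheses (N20 : (20 <= N)%N) (MN : (atoms mu <= N)%N) (f1 : fourier mu 1 = 0).
Hypothesis cyc : cyclic_order N th lab.
Hypothesis wN : forall l : 'I_(atoms mu), (2 * N%:R)^-1 <= weight l.

(* The trigonometric polynomial sine_kernel m be, with m * be = pi, is positive
   only within be of the origin and has mean zero.  Centred in a gap wider than
   3 pi / N it is nonpositive at every node and very negative at the left end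
   of the gap, whereas its integral is controlled by the low frequencies. *)
Lemma gap_lt (j : int) : 900 * (N%:R ^+ 4 * defect 3 N mu) < gap_const ^+ 2 ->
  th (j + 1) - th j < 3 * pi / N%:R.
Proof.
move=> Bsmall; rewrite ltNge; apply/negP => wide.
have p0 := @pi_gt0 R; have N0 : (0 < N)%N by lia.
set x : R := N%:R in wide Bsmall *; have x20 : 20 <= x by rewrite /x (ler_nat R 20).
have x0 : 0 < x by lra.
(* m > 3 N / 4 makes 9/4 be smaller than the gap; m <= 4 N / 5 keeps the frequencies in the band
   alpha = 4/5. *)
pose m := ((3 * N) %/ 4).+1; pose y : R := m%:R.
have m1 : (1 < m)%N by rewrite /m; clear -N20; lia.
have mN : (m <= N)%N by rewrite /m; clear -N20; lia.
have m2N : (m - 2 <= N)%N by exact: leq_trans (leq_subr _ _) mN.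
have y1 : 3 * x < 4 * y by rewrite /x /y -!natrM ltr_nat /m; clear; lia.
have y2 : 5 * y <= 4 * x by rewrite /x /y -!natrM ler_nat /m; clear -N20; lia.
have y0 : 0 < y by lra.
pose be := pi / y.
have mbe : y * be = pi by rewrite /be mulrC divfK // gt_eqF.
have be0 : 0 < be by rewrite divr_gt0.
have beN : 9 / 4 * be < 3 * pi / x.
  rewrite ltr_pdivlMr // /be mulrA mulrAC ltr_pdivrMr //; nra.
have be2 : be <= pi / 2 by nra.
(* The left end sits at t = -5/4 be, where 1 + cos (m t) = 1 - cos (pi / 4) is not 0, and the next
   node is still more than be to the right of [om]. *)
pose om := th j + 5 / 4 * be.
pose G t := sine_kernel m be t.
have sb0 : 0 <= sin be by apply: sin_ge0_pi; lra.
have GE t : (cos t - cos be) * G t = sin be * (1 + cos (y * t)).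
  exact: sine_kernelE.
have G_le0 t : be < t < 2 * pi - be -> G t <= 0.
  move=> bt; have := cos_lt_outside (ltW be0) bt.
  have := GE t; have := cos_geN1 (y * t); set P := sin be * _ => c1 E c2.
  have P0 : 0 <= P by rewrite mulr_ge0 //; lra.
  rewrite leNgt; apply/negP => Gt; nra.
pose kap : R := 1 - cos (pi / 4).
have kap0 : 0 < kap by rewrite subr_gt0 cos_pi4_lt1.
have Gj : 2 * kap * y / pi ^+ 2 <= - G (th j - om).
  have -> : th j - om = - (5 / 4 * be) by rewrite /om; ring.
  have := GE (- (5 / 4 * be)); rewrite cosN mulrN cosN.
  have -> : y * (5 / 4 * be) = pi / 4 + pi by rewrite mulrCA mbe; field.
  rewrite (cosDpi (pi / 4)) -/kap; set g := G _ => E.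
  have sb : 2 / pi * be <= sin be by apply: jordan_sin; lra.
  have c5 := one_sub_cos_le (5 / 4 * be); have cb := cos_le1 be.
  have c6 : cos (5 / 4 * be) < cos be by rewrite ltr_cos ?in_itv /=; lra.
  have g0 : 0 <= - g.
    rewrite leNgt; apply/negP => gneg.
    have : 0 <= sin be * kap by rewrite mulr_ge0 // ltW.
    rewrite -E; nra.
  (* cos be - cos (5/4 be) is at most (5/4 be)^2 / 2, hence at most be^2. *)
  have h1 : 2 / pi * be * kap <= - g * be ^+ 2.
    apply: (@le_trans _ _ (sin be * kap)); first by rewrite ler_pM2r.
    have -> : sin be * kap = - g * (cos be - cos (5 / 4 * be)) by rewrite -E; ring.
    by apply: ler_wpM2l => //; nra.
  have h2 : 2 / pi * kap <= - g * be.
    by rewrite -(ler_pM2r be0); lra.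
  have -> : 2 * kap * y / pi ^+ 2 = 2 / pi * kap / be.
    rewrite /be; move: p0 => /gt_eqF/negbT; move: (@pi R) => p p0.
    by field; rewrite p0 gt_eqF.
  by rewrite ler_pdivrMr.
pose I := \sum_(l < atoms mu) weight l * G (node l - om).
have I_le : gap_const <= - I.
  (* Index j + N carries the atom of j again; every other atom has a lift from [th (j + 1)] on and
     before [th j + 2 pi], where the polynomial is nonpositive. *)
  have bound l : l != lab j -> weight l * G (node l - om) <= 0.
    move=> lj; rewrite pmulr_rle0 ?weight_gt0 //.
    have [i /andP[ji iN] li] := cyc_window N0 cyc (j + 1) l.
    have ijN : i != j + N%:Z.
      apply: contraNneq lj => iE; apply/eqP/node_distinct.
      have [z zE] := li; have [_ _ /(_ j)[z' z'E] _] := cyc.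
      have := cyc_period N0 cyc j 1; rewrite mul1r -iE z'E => E.
      exists (z + z' + 1); rewrite zE E !intrD; ring.
    have -> : G (node l - om) = G (th i - om).
      by apply: sine_kernel_mod; have [z ->] := li; exists z; ring.
    apply: G_le0; have := cyc_le cyc ji.
    have : th i < th j + 2 * pi.
      have [_ <- _ _] := cyc; apply: (cyc_lt cyc).
      by clear -iN ijN; lia.
    rewrite /om; lra.
  have -> : I = weight (lab j) * G (node (lab j) - om) +
      \sum_(l < atoms mu | l != lab j) weight l * G (node l - om).
    by rewrite /I (bigD1 (lab j)).
  have rest : \sum_(l < atoms mu | l != lab j) weight l * G (node l - om) <= 0.
    exact: sumr_le0.
  have -> : G (node (lab j) - om) = G (th j - om).
    apply: sine_kernel_mod; have [_ _ /(_ j)[z ->] _] := cyc.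
    by exists (- z); rewrite mulrNz; ring.
  have w0 : 0 < weight (lab j) :> R by exact: weight_gt0.
  have h : (2 * x)^-1 * (2 * kap * y / pi ^+ 2) <= weight (lab j) * - G (th j - om).
    apply: ler_pM => //; first by rewrite invr_ge0; lra.
    by rewrite divr_ge0 ?sqr_ge0 // mulr_ge0 ?(ltW y0) // mulr_ge0 // ltW.
  have h' : gap_const <= (2 * x)^-1 * (2 * kap * y / pi ^+ 2).
    rewrite /gap_const -/kap.
    have E (p : R) : 0 < p -> (2 * x)^-1 * (2 * kap * y / p ^+ 2) -
        kap / (2 * p ^+ 2) = kap * (2 * y - x) / (2 * x * p ^+ 2).
      by move=> p0'; field; rewrite !gt_eqF.
    rewrite -subr_ge0 E // divr_ge0 ?mulr_ge0 ?exprn_ge0 ?ltW //; lra.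
  lra.
pose A k := \sum_(l < atoms mu) weight l * cos (k%:R * (node l - om)).
have IE : - I = \sum_(1 <= k < m) - (2 * sin (k%:R * be) * A k).
  rewrite /I sumrN; congr (- _).
  transitivity (\sum_(l < atoms mu) \sum_(1 <= k < m)
      2 * sin (k%:R * be) * (weight l * cos (k%:R * (node l - om)))).
    apply: eq_bigr => l _; rewrite /G /sine_kernel !mulr_sumr.
    by apply: eq_bigr => k _; ring.
  by rewrite exchange_big; apply: eq_bigr => k _; rewrite mulr_sumr.
have A1 : A 1%N = 0.
  have := cos_moment_le 1 om; rewrite (fourier_sq0 f1) -/(A 1%N) => h.
  by apply/eqP; rewrite -sqrf_eq0 eq_le h sqr_ge0.
have c0 := gap_const_gt0.
(* One half of [gap_const] pays for the terms s below, the other for the a k / s; the latter needs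
   225 B < la^2, which is the hypothesis with 900 = 4 * 225. *)
pose la := gap_const / 2; have la0 : 0 < la by rewrite /la; lra.
have I_ge : - I <= \sum_(2 <= k < m) (la / x + x ^+ 4 / la * (a k / k%:R ^+ 3)).
  rewrite IE big_ltn // A1 mulr0 oppr0 add0r; apply: ler_sum_nat => k /andP[k2 km].
  have k0 : 0 < k%:R :> R by rewrite ltr0n; exact: ltnW.
  have kx : k%:R <= x by rewrite /x ler_nat; exact: leq_trans (ltnW km) mN.
  (* The weight in the arithmetic-geometric mean inequality: proportional to k^3 to meet a k / k^3,
     and at most la / N, so that at most N terms add up to la. *)
  pose s := la * k%:R ^+ 3 / x ^+ 4.
  have s0 : 0 < s.
    by apply: divr_gt0; [apply: mulr_gt0 => //|]; exact: exprn_gt0.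
  have Ak := cos_moment_le k om; rewrite -/(A k) in Ak.
  apply: (@le_trans _ _ (s + a k / s)).
    set sg := sin _; have sg1 : sg ^+ 2 <= 1.
      by rewrite -(cos2Dsin2 (k%:R * be)) lerDr sqr_ge0.
    have h1 : - (2 * sg * A k) <= s * sg ^+ 2 + A k ^+ 2 / s.
      rewrite -subr_ge0.
      have -> : s * sg ^+ 2 + A k ^+ 2 / s - - (2 * sg * A k) = (s * sg + A k) ^+ 2 / s.
        by field; rewrite gt_eqF.
      by rewrite divr_ge0 ?sqr_ge0 // ltW.
    have h2 : s * sg ^+ 2 <= s by rewrite ler_piMr // ltW.
    have h3 : A k ^+ 2 / s <= a k / s by rewrite ler_pM2r ?invr_gt0.
    lra.
  apply: lerD.
    rewrite /s -mulrA ler_pM2l // ler_pdivrMr ?exprn_gt0 //.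
    have -> : x^-1 * x ^+ 4 = x ^+ 3 by field; rewrite gt_eqF.
    by rewrite lerXn2r ?nnegrE // ltW.
  rewrite le_eqVlt; apply/orP; left; apply/eqP; rewrite /s.
  by field; rewrite !gt_eqF.
(* The constant given by alpha = 4/5 is 16 * 125 / 9, about 222. *)
have low : \sum_(2 <= k < m) a k / k%:R ^+ 3 <= 225 * defect 3 N mu.
  have N1 : (1 < N)%N by exact: leq_trans m1 mN.
  have := @low_band_alpha R mu N N1 MN f1 (4 / 5) m.
  rewrite -/x => /(_ ltac:(lra) ltac:(lra)).
  set S := \sum_(2 <= k < m) _; have S0 : 0 <= S.
    by apply: sumr_ge0 => k _; rewrite divr_ge0 ?fourier_sq_ge0 ?exprn_ge0.
  have -> : 9 / 16 * (1 - 4 / 5) ^+ 3 = 9 / (16 * 125) :> R by field.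
  move=> h; have : 9 / (16 * 125) * S <= defect 3 N mu; last lra.
  apply: h => n nm; have : n%:R <= y by rewrite /y ler_nat ltnW.
  lra.
move: I_ge; rewrite big_split /= -!mulr_sumr.
have -> : \sum_(2 <= k < m) x^-1 = (m - 2)%:R * x^-1.
  by rewrite big_const_nat iter_addr_0 mulr_natl.
have e1 : la * ((m - 2)%:R * x^-1) <= la.
  by rewrite ler_piMr ?(ltW la0) // ler_pdivrMr // mul1r /x ler_nat.
have e2 : x ^+ 4 / la * (\sum_(2 <= k < m) a k / k%:R ^+ 3) <=
    x ^+ 4 / la * (225 * defect 3 N mu).
  by rewrite ler_wpM2l // divr_ge0 ?exprn_ge0 ?ltW.
have e3 : x ^+ 4 / la * (225 * defect 3 N mu) < la.
  rewrite mulrAC ltr_pdivrMr //; move: Bsmall; rewrite /la; nra.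
by move: I_le; rewrite /la in e1 e2 e3 *; lra.
Qed.

End WideGaps.

(** * Existence of a cyclic order *)

Section CyclicExistence.
Variables (R : realType) (N : nat) (mu : atomic_prob R).

(** Representatives in [0, 2 pi) are sorted; on division of the index by N, the remainder selects a
    node and the quotient counts the turns. *)
Lemma cyclic_order_exists : (0 < N)%N -> atoms mu = N ->
  exists th lab, @cyclic_order R N mu th lab.
Proof.
move=> N0 MN; have p0 := @pi_gt0 R; have p2 : 0 < 2 * pi :> R by lra.
have l0 : 'I_(atoms mu) by rewrite MN; exact: Ordinal N0.
pose fl (l : 'I_(atoms mu)) := Num.floor (node l / (2 * pi) : R).
pose r (l : 'I_(atoms mu)) := node l - (fl l)%:~R * (2 * pi).
have r_ge0 l : 0 <= r l.
  by rewrite subr_ge0 -ler_pdivlMr // floor_le_tmp.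
have r_lt l : r l < 2 * pi.
  have := floorD1_gt (node l / (2 * pi)).
  by rewrite -/(fl l) intrD ltr_pdivrMr // mulrDl mul1r /r; lra.
have r_mod l : eq_mod_2pi (r l) (node l).
  by exists (- fl l); rewrite mulrNz /r mulNr.
have r_inj l l' : r l = r l' -> l = l'.
  move=> E; apply: node_distinct; exists (fl l - fl l').
  by move: E; rewrite /r intrB => E; lra.
pose leT l l' := r l <= r l'.
have leT_total : total leT by move=> l l'; exact: le_total.
have leT_tr : transitive leT by move=> l l' l''; exact: le_trans.
pose s := sort leT (enum 'I_(atoms mu)).
have s_size : size s = N by rewrite size_sort size_enum_ord MN.
have s_uniq : uniq s by rewrite sort_uniq enum_uniq.
have s_all l : l \in s by rewrite mem_sort mem_enum.
have s_lt i j : (i < j < N)%N -> r (nth l0 s i) < r (nth l0 s j).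
  move=> /andP[ij jN]; rewrite lt_neqAle; apply/andP; split.
    apply/eqP => /r_inj/eqP; rewrite nth_uniq ?s_size //; first by rewrite ltn_eqF.
    exact: ltn_trans jN.
  apply: (sorted_ltn_nth leT_tr l0 (sort_sorted leT_total _)) => //.
    by rewrite inE s_size (ltn_trans ij).
  by rewrite inE s_size.
have Nz : N%:Z != 0 by rewrite eqz_nat -lt0n.
have N0z : 0 < N%:Z by rewrite ltz_nat.
pose ix (j : int) := `|(j %% N%:Z)%Z|%N.
pose lab j := nth l0 s (ix j).
pose th j := r (lab j) + (j %/ N%:Z)%Z%:~R * (2 * pi).
have ixE (j : int) : (ix j)%:Z = (j %% N%:Z)%Z by rewrite /ix gez0_abs ?modz_ge0.
have ix_lt (j : int) : (ix j < N)%N by rewrite -ltz_nat ixE ltz_pmod.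
exists th, lab; split.
- move=> i j ij; rewrite /th.
  have := divz_eq i N%:Z; have := divz_eq j N%:Z; rewrite -!ixE.
  set qi := (i %/ N%:Z)%Z; set qj := (j %/ N%:Z)%Z => jE iE.
  have ii := ix_lt i; have ji := ix_lt j.
  have [qq|qq|qq] := ltgtP qi qj.
  + have : (qi + 1)%:~R <= qj%:~R :> R by rewrite ler_int; lia.
    rewrite intrD => qq'; have := r_ge0 (lab j); have := r_lt (lab i).
    have : (qi%:~R + 1%:~R) * (2 * pi) <= qj%:~R * (2 * pi) :> R by rewrite ler_pM2r.
    rewrite mulrDl mul1r; lra.
  + exfalso; have : (qj + 1) * N%:Z <= qi * N%:Z by rewrite ler_pM2r //; lia.
    by rewrite mulrDl mul1r; lia.
  + rewrite qq ltrD2r; apply: s_lt; rewrite ji andbT.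
    by rewrite -ltz_nat; rewrite qq in iE; lia.
- move=> j; rewrite /th /lab /ix modzDr.
  have -> : ((j + N%:Z) %/ N%:Z)%Z = (j %/ N%:Z)%Z + 1.
    by rewrite divzDr ?dvdzz // divzz Nz.
  by rewrite intrD mulrDl mul1r addrA.
- move=> j; have [z zE] := r_mod (lab j); exists (z + (j %/ N%:Z)%Z).
  by rewrite /th zE intrD; ring.
- move=> l; exists (index l s)%:Z; rewrite /lab /ix.
  have lN : (index l s < N)%N by rewrite -s_size index_mem.
  by rewrite modz_small ?ltz_nat //= nth_index.
Qed.

End CyclicExistence.

(** * Rigidity of weights and gaps *)

Section Rigidity.
Variables (R : realType) (N : nat) (mu : atomic_prob R).
Hypotheses (N20 : (20 <= N)%N) (MN : (atoms mu <= N)%N) (f1 : fourier mu 1 = 0).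
Local Notation b3 := (inv_pow (3 : R)).
Local Notation B := (N%:R ^+ 4 * defect 3 N mu).

Let N1 : (1 < N)%N. Proof. exact: leq_trans N20. Qed.
Let N0 : (0 < N)%N. Proof. exact: leq_trans N20. Qed.
Let x0 : 0 < N%:R :> R. Proof. by rewrite ltr0n. Qed.

Lemma scaled_excess_le :
  \sum_(l < N) (N%:R * padded_weight mu l - 1) ^+ 2 <= B / 3.
Proof.
have -> : \sum_(l < N) (N%:R * padded_weight mu l - 1) ^+ 2 =
    N%:R ^+ 2 * \sum_(l < N) (padded_weight mu l - N%:R^-1) ^+ 2.
  rewrite mulr_sumr; apply: eq_bigr => l _.
  by rewrite -exprMn mulrBr divff // gt_eqF.
have := ler_wpM2l (sqr_ge0 N%:R) (excess_le_defect N1 MN f1).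
move=> h; apply: le_trans h _; lra.
Qed.

(** Each appended zero contributes (0 - 1)^2 = 1 to the scaled excess. *)
Lemma missing_atoms_le : (N - atoms mu)%:R <= B / 3.
Proof.
apply: le_trans scaled_excess_le.
rewrite (padded_sum (fun w => (N%:R * w - 1) ^+ 2) MN) mulr0 sub0r sqrrN expr1n mulr1.
by rewrite lerDr sumr_ge0 // => l _; exact: sqr_ge0.
Qed.

Lemma atoms_full : B < 3 -> atoms mu = N.
Proof.
move=> B3; apply/eqP; rewrite eqn_leq MN leqNgt; apply/negP => MltN.
have : 1 <= (N - atoms mu)%:R :> R by rewrite ler1n subn_gt0.
by have := missing_atoms_le; lra.
Qed.

Lemma weights_excess_le : \sum_(l < atoms mu) (N%:R * weight l - 1) ^+ 2 <= B / 3.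
Proof.
apply: le_trans scaled_excess_le.
rewrite (padded_sum (fun w => (N%:R * w - 1) ^+ 2) MN) lerDl.
by rewrite mulr_ge0 ?sqr_ge0.
Qed.

Lemma weight_close (l : 'I_(atoms mu)) : (N%:R * weight l - 1) ^+ 2 <= B / 3.
Proof.
apply: le_trans weights_excess_le.
by rewrite (bigD1 l) //= lerDl sumr_ge0 // => i _; exact: sqr_ge0.
Qed.

Lemma weight_half : B < 3 / 4 -> forall l : 'I_(atoms mu), (2 * N%:R)^-1 <= weight l.
Proof.
move=> B34 l; have := weight_close l.
have -> : (2 * N%:R)^-1 = 2^-1 / N%:R :> R by rewrite invfM.
by rewrite ler_pdivrMr // => h; nra.
Qed.

Variables (th : int -> R) (lab : int -> 'I_(atoms mu)).
Hypothesis cyc : cyclic_order N th lab.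

(** The kernel is nonnegative, so for each atom only the pair with its successor is kept;
    periodicity of the kernel permits lifted differences. *)
Lemma adjacent_pair_energy T : \sum_(j < N) weight (lab (j%:Z + 1)) * weight (lab j%:Z) *
    kernel N T (fun n => diff4 b3 (N + n - 2)%N) (th (j%:Z + 1) - th j%:Z)
  <= pair_energy mu N T b3.
Proof.
rewrite /pair_energy /pair_sum exchange_big /=.
have p3 : 1 < 3 :> R by lra.
have [_ d4] := monotone4_inv_pow p3.
rewrite (reindex (fun j : 'I_N => lab j%:Z)) /=; last first.
  by have [g fg gf] := cyc_bij N0 cyc MN; exists g => i _.
apply: ler_sum => j _; rewrite (bigD1 (lab (j%:Z + 1))) //=.
have -> : kernel N T (fun n => diff4 b3 (N + n - 2)%N) (th (j%:Z + 1) - th j%:Z) =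
    kernel N T (fun n => diff4 b3 (N + n - 2)%N) (node (lab (j%:Z + 1)) - node (lab j%:Z)).
  apply: kernel_mod; have [_ _ tl _] := cyc.
  have [z ->] := tl (j%:Z + 1); have [z' ->] := tl j%:Z.
  by exists (z - z'); rewrite intrB; ring.
rewrite lerDl sumr_ge0 // => l _; rewrite mulr_ge0 ?kernel_ge0 //.
  by rewrite mulr_ge0 // ltW // weight_gt0.
by move=> n n0; apply/ltW/d4; clear -N1 n0; lia.
Qed.

(** [gap_lt] brings every gap into the range of [kernel_gap_ge]. The two weights cost 4 N^2 and the
    kernel N^2, hence N^4 times the defect. *)
Lemma gaps_le : B < 3 / 4 -> 900 * B < gap_const R ^+ 2 ->
  \sum_(j < N) ((th (j%:Z + 1) - th j%:Z) / (2 * pi / N%:R) - 1) ^+ 2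
  <= 4 / gap_weight R * B.
Proof.
move=> B34 B900; have w2 := weight_half B34.
have gw0 := gap_weight_gt0 R.
have N12 : (12 <= N)%N by exact: leq_trans N20.
have D := pair_le_defect N1 MN f1 (N %/ 3).
have := le_trans (adjacent_pair_energy (N %/ 3)) D.
set et := fun j : int => (th (j + 1) - th j) / (2 * pi / N%:R) - 1.
move=> h; have {}h : \sum_(j < N) (2 * N%:R)^-1 * (2 * N%:R)^-1 *
    (gap_weight R / N%:R ^+ 2 * et j%:Z ^+ 2) <= defect 3 N mu.
  apply: le_trans h; apply: ler_sum => j _.
  have i0 : 0 <= (2 * N%:R)^-1 :> R by rewrite invr_ge0 mulr_ge0.
  apply: ler_pM.
  - exact: mulr_ge0.
  - by rewrite mulr_ge0 ?sqr_ge0 // divr_ge0 ?sqr_ge0 // ltW.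
  - exact: ler_pM.
  - have g0 : 0 < th (j%:Z + 1) - th j%:Z.
      by rewrite subr_gt0; apply: (cyc_lt cyc); rewrite ltrDl.
    have g1 := gap_lt N20 MN f1 cyc w2 j%:Z B900.
    have := @kernel_gap_ge R N (th (j%:Z + 1) - th j%:Z) N12.
    rewrite g0 (ltW g1) => /(_ isT); apply: le_trans.
    suff -> : et j%:Z = (th (j%:Z + 1) - th j%:Z) * N%:R / (2 * pi) - 1 by [].
    by rewrite /et invf_div; congr (_ - 1); exact: mulrA.
have -> : \sum_(j < N) et j%:Z ^+ 2 = 4 / gap_weight R * N%:R ^+ 4 *
    \sum_(j < N) (2 * N%:R)^-1 * (2 * N%:R)^-1 *
    (gap_weight R / N%:R ^+ 2 * et j%:Z ^+ 2).
  rewrite mulr_sumr; apply: eq_bigr => j _.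
  by field; rewrite !gt_eqF.
rewrite [leRHS]mulrA ler_wpM2l // mulr_ge0 ?exprn_ge0 //.
by rewrite divr_ge0 // ltW.
Qed.

Lemma cyc_weights_excess :
  \sum_(j < N) (N%:R * weight (lab j%:Z) - 1) ^+ 2 <= B / 3.
Proof.
apply: le_trans weights_excess_le.
rewrite [leRHS](reindex (fun j : 'I_N => lab j%:Z)) //=.
by have [g fg gf] := cyc_bij N0 cyc MN; exists g => i _.
Qed.

End Rigidity.

(** * From gaps to positions *)

Section Drift.
Variables (R : realType) (N : nat) (th : int -> R) (h : R).
Hypotheses (N0 : (0 < N)%N) (h0 : 0 < h).

Let et (j : int) : R := (th (j + 1) - th j) / h - 1.

(** Take for [gamma] the mean of th j - j h, which centres y. The increments of y are h eta_j, so
    its oscillation is at most h times the sum of |eta_j|; with mean 0, each |y_j| is bounded by the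
    oscillation, and Cauchy-Schwarz brings in the factor N. *)
Lemma drift_le : exists gamma : R,
  let y (j : int) := th j - gamma - j%:~R * h in
  \sum_(j < N) y j%:Z = 0 /\
  forall j : 'I_N, y j%:Z ^+ 2 <= h ^+ 2 * N%:R * \sum_(i < N) et i%:Z ^+ 2.
Proof.
have x0 : 0 < N%:R :> R by rewrite ltr0n.
pose g := (\sum_(j < N) (th j%:Z - j%:R * h)) / N%:R; exists g => y.
have yE (j : nat) : y j%:Z = (th j%:Z - j%:R * h) - g by rewrite /y -pmulrn; ring.
have y0 : \sum_(j < N) y j%:Z = 0.
  under eq_bigr do rewrite yE; rewrite sumrB sumr_const card_ord -mulr_natr /g.
  by rewrite divfK ?subrr // gt_eqF.
split=> // j.
pose W := \sum_(i < N) h * `|et i%:Z|.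
have step (i : nat) : y i.+1%:Z - y i%:Z = h * et i%:Z.
  rewrite !yE /et -(natr1 i) (_ : i.+1%:Z = i%:Z + 1); last by rewrite -addn1 PoszD.
  by field; rewrite gt_eqF.
have up (i k : nat) : (i <= k)%N -> (k <= N)%N -> `|y k%:Z - y i%:Z| <= W.
  move=> ik kN.
  rewrite -(telescope_sumr (fun i : nat => y i%:Z)) //.
  under eq_bigr do rewrite step.
  apply: le_trans (ler_norm_sum _ _ _) _.
  under eq_bigr do rewrite normrM (gtr0_norm h0).
  rewrite /W -(big_mkord xpredT (fun i => h * `|et i%:Z|)).
  have t0 (n : nat) : 0 <= h * `|et n%:Z| by rewrite mulr_ge0 // ltW.
  apply: (@le_trans _ _ (\sum_(i <= n < N) h * `|et n%:Z|)).
    by apply: ler_sum_nat_widen.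
  rewrite [leRHS](@big_cat_nat _ _ _ i) //=; last exact: leq_trans kN.
  by rewrite lerDr sumr_ge0.
have osc (i k : 'I_N) : y i%:Z - y k%:Z <= W.
  have [ik|/ltnW ki] := leqP i k.
    by apply: le_trans (ler_norm _) _; rewrite distrC up // ltnW.
  by apply: le_trans (ler_norm _) _; rewrite up // ltnW.
have yj : `|y j%:Z| <= W.
  have sW : \sum_(k < N) W = N%:R * W by rewrite sumr_const card_ord mulr_natl.
  rewrite ler_norml -(ler_pM2l x0) -[X in _ && X](ler_pM2l x0) -sW.
  have -> : N%:R * y j%:Z = \sum_(k < N) (y j%:Z - y k%:Z).
    by rewrite sumrB y0 subr0 sumr_const card_ord mulr_natl.
  rewrite mulrN -sW lerNl -sumrN; apply/andP; split; apply: ler_sum => k _ //.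
  by rewrite opprB.
have W0 : 0 <= W by apply: sumr_ge0 => i _; rewrite mulr_ge0 // ltW.
rewrite -real_normK ?num_real //.
apply: (@le_trans _ _ (W ^+ 2)); first by rewrite lerXn2r ?nnegrE.
rewrite /W -mulr_sumr exprMn -mulrA ler_pM2l ?exprn_gt0 //.
apply: le_trans (sqr_sum_le _) _; rewrite ler_pM2l //.
by apply: ler_sum => i _; rewrite real_normK ?num_real.
Qed.

End Drift.

(** * Assembling the four parts *)

Section Consequences.
Variable R : realType.

Lemma is_lattice_iff N (mu : atomic_prob R) : (0 < N)%N -> (atoms mu <= N)%N ->
  (exists gamma, eq_circle_measure (circle_measure mu) (lattice_measure N gamma))
  <-> lattice_like mu N.
Proof.
by move=> N0 MN; split; [exact: lattice_of_measure|exact: measure_of_lattice].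
Qed.

Lemma power_seriesE (mu : atomic_prob R) (p : R) m :
  \rsum_(m <= k <oo) (fourier_sq mu k / k%:R `^ p) =
  \rsum_(m <= k <oo) (inv_pow p k * fourier_sq mu k).
Proof. by apply: eq_series => k _; rewrite mulrC. Qed.

Section OneMeasure.
Variables (N : nat) (mu : atomic_prob R).
Hypotheses (N1 : (1 < N)%N) (MN : (atoms mu <= N)%N).

Let energies_ge0 b : monotone4 b ->
  0 <= low_energy mu N b + mass_energy mu N b + pair_energy mu N 1 b.
Proof.
move=> mb; rewrite addr_ge0 ?pair_energy_ge0 // addr_ge0 ?low_energy_ge0 //.
exact: mass_energy_ge0.
Qed.

Lemma poisson_ge (q : R) : 0 < q < 1 ->
  q ^+ N / (1 - q ^+ N) <= \rsum_(1 <= k <oo) (q ^+ k * fourier_sq mu k).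
Proof.
move=> q01; have mb := monotone4_expr q01.
rewrite -series_expr_multiples //; last exact: ltnW.
have := series_energy_ge 1 mb N1 MN (fun n => sum_expr_le n q01).
by have := energies_ge0 mb; lra.
Qed.

Lemma poisson_eq (q : R) : 0 < q < 1 ->
  \rsum_(1 <= k <oo) (q ^+ k * fourier_sq mu k) = q ^+ N / (1 - q ^+ N)
  <-> lattice_like mu N.
Proof.
move=> q01; rewrite -series_expr_multiples //; last exact: ltnW.
exact: series_energy_eq (monotone4_expr q01) N1 MN (fun n => sum_expr_le n q01).
Qed.

Lemma power_ge (p : R) : 1 < p ->
  zeta p / N%:R `^ p <= \rsum_(1 <= k <oo) (fourier_sq mu k / k%:R `^ p).
Proof.
move=> p1; have mb := monotone4_inv_pow p1.
rewrite power_seriesE -series_inv_pow_multiples //; last exact: ltnW.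
have := series_energy_ge 1 mb N1 MN (fun n => inv_pow_sum_le n p1).
by have := energies_ge0 mb; lra.
Qed.

Lemma power_eq (p : R) : 1 < p ->
  \rsum_(1 <= k <oo) (fourier_sq mu k / k%:R `^ p) = zeta p / N%:R `^ p
  <-> lattice_like mu N.
Proof.
move=> p1; rewrite power_seriesE -series_inv_pow_multiples //; last exact: ltnW.
exact: series_energy_eq (monotone4_inv_pow p1) N1 MN (fun n => inv_pow_sum_le n p1).
Qed.

End OneMeasure.

(** The mass energy already gives the factor 1/3 in place of 2 e^4, so e^4 >= 1 is enough. The other
    two bounds single out parts of N^2 times the excess: the appended zeros, or one weight. *)
Lemma weight_rigidity N (mu : atomic_prob R) : (1 < N)%N -> (atoms mu <= N)%N ->
  fourier mu 1 = 0 ->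
  [/\ \sum_(l < N) (padded_weight mu l - N%:R^-1) ^+ 2
        <= 2 * expR 4 * N%:R ^+ 2 * defect 3 N mu,
      N%:R - (atoms mu)%:R <= 2 * expR 4 * N%:R ^+ 4 * defect 3 N mu &
      \big[Num.max/0]_(l < N) (`|N%:R * padded_weight mu l - 1| ^+ 2)
        <= 2 * expR 4 * N%:R ^+ 4 * defect 3 N mu].
Proof.
move=> N1 MN f1; have D0 := defect_ge0 N1 MN f1.
have e4 : 1 <= expR 4 :> R by have := expR_ge1Dx (4 : R); lra.
have x0 : 0 < N%:R :> R by rewrite ltr0n ltnW.
have N2D : 0 <= N%:R ^+ 2 * defect 3 N mu by rewrite mulr_ge0 ?exprn_ge0.
have eN : N%:R ^+ 2 * defect 3 N mu <= 2 * expR 4 * N%:R ^+ 2 * defect 3 N mu.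
  by rewrite -mulrA ler_peMl //; lra.
set S := \sum_(l < N) (padded_weight mu l - N%:R^-1) ^+ 2.
have SD : S <= N%:R ^+ 2 * defect 3 N mu.
  by apply: le_trans (excess_le_defect N1 MN f1) _; lra.
have SN : N%:R ^+ 2 * S <= 2 * expR 4 * N%:R ^+ 4 * defect 3 N mu.
  apply: le_trans (ler_wpM2l (sqr_ge0 _) (le_trans SD eN)) _.
  by rewrite le_eqVlt; apply/orP; left; apply/eqP; ring.
split; first exact: le_trans eN.
  apply: le_trans SN; rewrite /S.
  rewrite (padded_sum (fun x => (x - N%:R^-1) ^+ 2) MN) sub0r sqrrN mulrDr.
  rewrite -natrB //; have -> : N%:R ^+ 2 * ((N - atoms mu)%:R * N%:R^-1 ^+ 2) =
    (N - atoms mu)%:R :> R by field; rewrite gt_eqF.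
  rewrite lerDr mulr_ge0 ?sqr_ge0 //; apply: sumr_ge0 => l _; exact: sqr_ge0.
apply: bigmax_le => [|l _].
  by apply: le_trans SN; rewrite mulr_ge0 ?sqr_ge0 //; apply: sumr_ge0 => l _; exact: sqr_ge0.
apply: le_trans SN; rewrite real_normK ?num_real //.
have -> : N%:R * padded_weight mu l - 1 = N%:R * (padded_weight mu l - N%:R^-1).
  by rewrite mulrBr divff // gt_eqF.
rewrite exprMn ler_pM2l ?exprn_gt0 // /S (bigD1 l) //= lerDl.
by apply: sumr_ge0 => i _; exact: sqr_ge0.
Qed.

Lemma low_band_coercive (alpha : R) : 0 < alpha < 1 ->
  exists (Nalpha : nat) (Calpha : R), forall (N : nat) (mu : atomic_prob R),
    (2 <= N)%N -> (Nalpha <= N)%N -> admissible N mu -> fourier mu 1 = 0 ->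
    \sum_(2 <= k < (Num.truncn (alpha * N%:R)).+1) fourier_sq mu k / k%:R ^+ 3
      <= Calpha * defect 3 N mu.
Proof.
move=> al; have /andP[al0 al1] := al.
(* From this threshold on, 2 <= (1 - alpha) N as [low_band_alpha] requires. *)
exists (Num.truncn (2 / (1 - alpha))).+1, (9 / 16 * (1 - alpha) ^+ 3)^-1.
move=> N mu N1 aN /andP[_ MN] f1.
have c0 : 0 < 9 / 16 * (1 - alpha) ^+ 3 by rewrite mulr_gt0 // exprn_gt0 // subr_gt0.
rewrite ler_pdivlMl //; apply: low_band_alpha => //.
  rewrite mulrC -ler_pdivrMr ?subr_gt0 //.
  apply: (@le_trans _ _ (Num.truncn (2 / (1 - alpha))).+1%:R); last by rewrite ler_nat.
  by apply/ltW/truncnS_gt.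
move=> n; rewrite ltnS => nK; apply: (@le_trans _ _ (Num.truncn (alpha * N%:R))%:R).
  by rewrite ler_nat.
by rewrite truncn_le mulr_ge0 // ltW.
Qed.

(** The factor 1 + c dominates both c and its square root, so one constant serves the linear and the
    square-root bounds. *)
Lemma mul_sqrt_bound (x c b : R) : 0 <= c -> 0 <= b -> x ^+ 2 <= c * b ->
  `|x| <= (1 + c) * Num.sqrt b.
Proof.
move=> c0 b0 xb; rewrite -[leRHS]ger0_norm; last by rewrite mulr_ge0 ?sqrtr_ge0 //; lra.
rewrite -ler_sqr ?nnegrE //; rewrite !real_normK ?num_real // exprMn sqr_sqrtr //.
by apply: le_trans xb _; rewrite ler_wpM2r //; nra.
Qed.

(** The 1 covers the weights, the other term the gaps. *)
Definition rigidity_const : R := 1 + 4 / gap_weight R.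
(** 4 pi^2 is (h N)^2 for h = 2 pi / N; the leading 1 comes from [mul_sqrt_bound]. *)
Definition drift_const : R := 1 + 4 * pi ^+ 2 * rigidity_const.

Lemma rigidity_const_ge1 : 1 <= rigidity_const.
Proof. by rewrite lerDl divr_ge0 // ltW // gap_weight_gt0. Qed.

Lemma drift_const_ge : rigidity_const <= drift_const.
Proof.
have := @pi_ge2 R; have := rigidity_const_ge1; rewrite /drift_const => c1 p2.
have : 1 <= 4 * pi ^+ 2 :> R by nra.
nra.
Qed.

Section Microscopic.
Variables (N : nat) (mu : atomic_prob R) (th : int -> R) (lab : int -> 'I_(atoms mu)).
Hypotheses (N20 : (20 <= N)%N) (MN : (atoms mu <= N)%N) (f1 : fourier mu 1 = 0).
Hypothesis cyc : cyclic_order N th lab.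
Let B : R := N%:R ^+ 4 * defect 3 N mu.
Hypotheses (B34 : B < 3 / 4) (B900 : 900 * B < gap_const R ^+ 2).
Let h : R := 2 * pi / N%:R.
Let eps (j : int) : R := N%:R * weight (lab j) - 1.
Let eta (j : int) : R := (th (j + 1) - th j) / h - 1.

Let N1 : (1 < N)%N. Proof. exact: leq_trans N20. Qed.
Let x0 : 0 < N%:R :> R. Proof. by rewrite ltr0n ltnW. Qed.
Let B0 : 0 <= B. Proof. by rewrite mulr_ge0 ?exprn_ge0 ?defect_ge0. Qed.

Lemma rigidity_sum :
  \sum_(j < N) (eps j%:Z ^+ 2 + eta j%:Z ^+ 2) <= rigidity_const * B.
Proof.
rewrite big_split /=; have := cyc_weights_excess N20 MN f1 cyc.
have := gaps_le N20 MN f1 cyc B34 B900.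
rewrite -/B -/h /rigidity_const mulrDl mul1r /eps /eta => h1 h2.
move: h1 h2; set u := \sum_(j < N) _ ; set v := \sum_(j < N) _; move=> h1 h2.
by move: B0; lra.
Qed.

Lemma rigidity_term (j : 'I_N) : eps j%:Z ^+ 2 + eta j%:Z ^+ 2 <= rigidity_const * B.
Proof.
apply: le_trans rigidity_sum; rewrite [leRHS](bigD1 j) //= lerDl.
by apply: sumr_ge0 => i _; rewrite addr_ge0 ?sqr_ge0.
Qed.

Lemma rigidity_max (e : R) : 0 <= e -> 2 * rigidity_const * B <= e ^+ 2 ->
  \big[Num.max/0]_(j < N) (`|eps j%:Z| + `|eta j%:Z|) <= e.
Proof.
move=> e0 Be; apply: bigmax_le => // j _.
have := rigidity_term j.
rewrite -[eps _ ^+ 2]real_normK ?num_real // -[eta _ ^+ 2]real_normK ?num_real //.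
set u := `|_|; set v := `|_| => uv.
rewrite -ler_sqr ?nnegrE // ?addr_ge0 ?normr_ge0 //; apply: le_trans Be.
have := sqr_ge0 (u - v); nra.
Qed.

Lemma rigidity_drift : exists gamma : R,
  let y (j : int) := th j - gamma - j%:~R * h in
  let u (j : int) := weight (lab j) - N%:R^-1 in
  [/\ \sum_(j < N) y j%:Z = 0,
      \sum_(j < N) `|y j%:Z| ^+ 2 <= drift_const * B,
      \big[Num.max/0]_(j < N) `|y j%:Z| <= drift_const * Num.sqrt (B / N%:R),
      \sum_(j < N) `|u j%:Z| ^+ 2 <= drift_const * B / N%:R ^+ 2 &
      \big[Num.max/0]_(j < N) `|u j%:Z| <= drift_const * Num.sqrt B / N%:R].
Proof.
have h0 : 0 < h by rewrite divr_gt0 // mulr_gt0 // pi_gt0.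
have c1 := rigidity_const_ge1; have cd := drift_const_ge.
have [g [y0 yb]] := drift_le th (ltnW N1) h0.
exists g => y u.
pose c := 4 * pi ^+ 2 * rigidity_const.
have c0 : 0 <= c.
  by apply: mulr_ge0; [apply: mulr_ge0; [|exact: sqr_ge0]|]; lra.
have dE : drift_const = 1 + c by [].
have yB (j : 'I_N) : y j%:Z ^+ 2 <= c * (B / N%:R).
  apply: le_trans (yb j) _.
  have et2 : \sum_(i < N) eta i%:Z ^+ 2 <= rigidity_const * B.
    apply: le_trans rigidity_sum; apply: ler_sum => i _.
    by rewrite lerDr sqr_ge0.
  apply: (@le_trans _ _ (h ^+ 2 * N%:R * (rigidity_const * B))).
    by rewrite ler_wpM2l // mulr_ge0 ?sqr_ge0.
  have E (p : R) : (2 * p / N%:R) ^+ 2 * N%:R * (rigidity_const * B) =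
      4 * p ^+ 2 * rigidity_const * (B / N%:R) by field; rewrite gt_eqF.
  by rewrite /h E.
have uB : \sum_(j < N) `|u j%:Z| ^+ 2 <= B / N%:R ^+ 2.
  rewrite ler_pdivlMr ?exprn_gt0 // mulr_suml.
  apply: (@le_trans _ _ (B / 3)); last by move: B0; lra.
  apply: le_trans (cyc_weights_excess N20 MN f1 cyc).
  apply: ler_sum => j _; rewrite real_normK ?num_real // -exprMn.
  by rewrite /u mulrBl mulVf ?gt_eqF // mulrC.
split=> //.
- apply: (@le_trans _ _ (\sum_(j < N) c * (B / N%:R))).
    by apply: ler_sum => j _; rewrite real_normK ?num_real.
  rewrite sumr_const card_ord -[leLHS]mulr_natr.
  have -> : c * (B / N%:R) * N%:R = c * B by field; rewrite gt_eqF.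
  by rewrite dE ler_wpM2r //; lra.
- have BN0 : 0 <= B / N%:R by rewrite divr_ge0.
  apply: bigmax_le => [|j _]; first by rewrite mulr_ge0 ?sqrtr_ge0 //; lra.
  by rewrite dE; apply: mul_sqrt_bound.
- apply: le_trans uB _; rewrite -mulrA ler_peMl ?divr_ge0 ?sqr_ge0 //; lra.
- apply: bigmax_le => [|j _]; first by rewrite divr_ge0 // mulr_ge0 ?sqrtr_ge0 //; lra.
  rewrite ler_pdivlMr // -[X in _ * X <= _](gtr0_norm x0) -normrM dE.
  apply: mul_sqrt_bound => //.
  have : `|u j%:Z| ^+ 2 <= B / N%:R ^+ 2.
    apply: le_trans uB; rewrite [leRHS](bigD1 j) //= lerDl.
    by apply: sumr_ge0 => i _; exact: sqr_ge0.
  rewrite real_normK ?num_real // ler_pdivlMr ?exprn_gt0 // -exprMn => ub.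
  apply: le_trans ub _; rewrite -[leLHS]mul1r ler_wpM2r //.
  rewrite /c; have := @pi_ge2 R => p2; have : 1 <= 4 * pi ^+ 2 :> R by nra.
  nra.
Qed.

End Microscopic.
End Consequences.

Theorem theorem4p3 (R : realType) :
  (* (i) *)
  (forall (N : nat) (mu : atomic_prob R), (2 <= N)%N -> admissible N mu ->
    let is_lattice := exists gamma : R,
      eq_circle_measure (circle_measure mu) (lattice_measure N gamma) in
    let poisson (q : R) := \rsum_(1 <= k <oo) (q ^+ k * fourier_sq mu k) in
    let power (p : R) := \rsum_(1 <= k <oo) (fourier_sq mu k / k%:R `^ p) in
    [/\ forall q : R, 0 < q < 1 -> q ^+ N / (1 - q ^+ N) <= poisson q,
        (exists2 q : R, 0 < q < 1 & poisson q = q ^+ N / (1 - q ^+ N))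
          <-> is_lattice,
        is_lattice ->
          forall q : R, 0 < q < 1 -> poisson q = q ^+ N / (1 - q ^+ N),
        (forall p : R, 1 < p -> zeta p / N%:R `^ p <= power p) /\
        (forall p : R, 1 < p ->
          (power p = zeta p / N%:R `^ p <-> is_lattice)) &
        fourier mu 1 = 0 ->
          (forall q : R, 0 < q < 1 ->
            poisson q = \rsum_(2 <= k <oo) (q ^+ k * fourier_sq mu k)) /\
          (forall p : R, 1 < p ->
            power p = \rsum_(2 <= k <oo) (fourier_sq mu k / k%:R `^ p))])
  /\
  (* (ii) *)
  (forall (N : nat) (mu : atomic_prob R), (2 <= N)%N -> admissible N mu ->
    fourier mu 1 = 0 ->
    let w (l : 'I_N) := padded_weight mu l in
    [/\ \sum_(l < N) (w l - N%:R^-1) ^+ 2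
          <= 2 * expR 4 * N%:R ^+ 2 * defect 3 N mu,
        N%:R - (atoms mu)%:R <= 2 * expR 4 * N%:R ^+ 4 * defect 3 N mu &
        \big[Num.max/0]_(l < N) (`|N%:R * w l - 1| ^+ 2)
          <= 2 * expR 4 * N%:R ^+ 4 * defect 3 N mu])
  /\
  (* (iii) *)
  ((forall alpha : R, 0 < alpha < 1 ->
     exists (Nalpha : nat) (Calpha : R),
     forall (N : nat) (mu : atomic_prob R),
       (2 <= N)%N -> (Nalpha <= N)%N -> admissible N mu -> fourier mu 1 = 0 ->
       \sum_(2 <= k < (Num.truncn (alpha * N%:R)).+1)
           fourier_sq mu k / k%:R ^+ 3
         <= Calpha * defect 3 N mu) /\
   (forall (N : nat) (mu : atomic_prob R),
      (20 <= N)%N -> admissible N mu -> fourier mu 1 = 0 ->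
      \sum_(2 <= k < (N %/ 10).+1) fourier_sq mu k / k%:R ^+ 3
        <= 5 / 4 * defect 3 N mu))
  /\
  (* (iv) *)
  (exists C : R,
    forall (N : nat -> nat) (mu : nat -> atomic_prob R),
      (forall nu, (2 <= N nu)%N) ->
      N n @[n --> \oo] --> \oo ->
      (forall nu, admissible (N nu) (mu nu)) ->
      (forall nu, fourier (mu nu) 1 = 0) ->
      let B (nu : nat) : R := (N nu)%:R ^+ 4 * defect 3 (N nu) (mu nu) in
      B nu @[nu --> \oo] --> (0 : R) ->
      [/\ \forall nu \near \oo, atoms (mu nu) = N nu,
          \forall nu \near \oo, exists th lab,
            @cyclic_order R (N nu) (mu nu) th lab &
          forall (th : nat -> int -> R)
                 (lab : forall nu : nat, int -> 'I_(atoms (mu nu))),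
            (\forall nu \near \oo,
               @cyclic_order R (N nu) (mu nu) (th nu) (lab nu)) ->
            let h (nu : nat) : R := 2 * pi / (N nu)%:R in
            let w (nu : nat) (j : int) : R := weight (lab nu j) in
            let eps (nu : nat) (j : int) : R := (N nu)%:R * w nu j - 1 in
            let eta (nu : nat) (j : int) : R :=
              (th nu (j + 1) - th nu j) / h nu - 1 in
            let u (nu : nat) (j : int) : R := w nu j - (N nu)%:R^-1 in
            [/\ (\big[Num.max/0]_(j < N nu) (`|eps nu j| + `|eta nu j|))
                  @[nu --> \oo] --> (0 : R),
                \forall nu \near \oo,
                  \sum_(j < N nu) (eps nu j ^+ 2 + eta nu j ^+ 2)
                    <= C * B nu &
                \forall nu \near \oo, exists gamma : R,
                  let y (j : int) : R :=
                    th nu j - gamma - j%:~R * h nu in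
                  [/\ \sum_(j < N nu) y j = 0,
                      \sum_(j < N nu) `|y j| ^+ 2 <= C * B nu,
                      \big[Num.max/0]_(j < N nu) `|y j|
                        <= C * Num.sqrt (B nu / (N nu)%:R),
                      \sum_(j < N nu) `|u nu j| ^+ 2
                        <= C * B nu / (N nu)%:R ^+ 2 &
                      \big[Num.max/0]_(j < N nu) `|u nu j|
                        <= C * Num.sqrt (B nu) / (N nu)%:R]]]).
Proof.
split=> [N mu N1 adm|].
  have /andP[M0 MN] := adm; move=> L poisson power.
  have LE : L <-> lattice_like mu N by apply: is_lattice_iff; [exact: ltnW|].
  split.
  - by move=> q q01; exact: poisson_ge.
  - split=> [[q q01 /(poisson_eq N1 MN q01)/LE]//|/LE lat].
    have q01 : 0 < (1 / 2 : R) < 1 by apply/andP; split; lra.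
    by exists (1 / 2) => //; apply/(poisson_eq N1 MN q01).
  - by move=> /LE lat q q01; apply/(poisson_eq N1 MN q01).
  - split=> p p1; first exact: power_ge.
    by rewrite LE; exact: power_eq.
  - move=> f1; have a1 := fourier_sq0 f1.
    by split=> [q q01|p p1]; rewrite /poisson /power seriesS_recl // a1 ?mulr0 ?mul0r.
split=> [N mu N1 /andP[_ MN] f1 w|]; first exact: weight_rigidity.
split.
  split; first exact: low_band_coercive.
  by move=> N mu N20 /andP[_ MN] f1; apply: low_band_tenth => //; exact: leq_trans N20.
(* [drift_const] dominates [rigidity_const], so it serves all the estimates. *)
exists (drift_const R) => N mu N1 Noo adm f1 B B0.
have MN nu : (atoms (mu nu) <= N nu)%N by have /andP[] := adm nu.
have Bge nu : 0 <= B nu by rewrite mulr_ge0 ?exprn_ge0 ?defect_ge0.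
have N20 : \forall nu \near \oo, (20 <= N nu)%N by exact: (cvgnyPge _).1 Noo 20%N.
have B34 : \forall nu \near \oo, B nu < 3 / 4 by apply: cvgr_lt B0 _ _; lra.
have B900 : \forall nu \near \oo, 900 * B nu < gap_const R ^+ 2.
  have : \forall nu \near \oo, B nu < gap_const R ^+ 2 / 900.
    have g0 : 0 < gap_const R ^+ 2 by rewrite exprn_gt0 // gap_const_gt0.
    by apply: cvgr_lt B0 _ _; lra.
  by apply: filterS => nu; lra.
have full : \forall nu \near \oo, atoms (mu nu) = N nu.
  apply: filterS2 N20 B34 => nu N20 Bn; apply: atoms_full => //.
  by rewrite -/(B nu); lra.
split=> //.
  by apply: filterS full => nu; apply: cyclic_order_exists; exact: ltnW.
move=> th lab cyc h w eps eta u.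
(* The estimates hold for every single nu with these four properties; letting B tend to 0 is used
   beyond them only for the limit of the maximum. *)
have good : \forall nu \near \oo, [/\ (20 <= N nu)%N, B nu < 3 / 4,
    900 * B nu < gap_const R ^+ 2 & cyclic_order (N nu) (th nu) (lab nu)].
  by near=> nu; split; near: nu.
split.
- apply/cvgr0Pnorm_le => e e0.
  have Be : \forall nu \near \oo, 2 * rigidity_const R * B nu <= e ^+ 2.
    have c1 := rigidity_const_ge1 R.
    have : \forall nu \near \oo, B nu < e ^+ 2 / (2 * rigidity_const R).
      by apply: cvgr_lt B0 _ _; rewrite divr_gt0 ?exprn_gt0 //; lra.
    apply: filterS => nu; rewrite ltr_pdivlMr; last by lra.
    by rewrite mulrC => /ltW.
  apply: filterS2 Be good => nu Bn [n20 b34 b900 cy].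
  rewrite ger0_norm ?bigmax_ge_id //.
  exact: rigidity_max n20 (MN nu) (f1 nu) cy b34 b900 _ (ltW e0) Bn.
- apply: filterS good => nu [n20 b34 b900 cy].
  apply: le_trans (rigidity_sum n20 (MN nu) (f1 nu) cy b34 b900) _.
  by apply: ler_wpM2r; [exact: Bge|exact: drift_const_ge].
- apply: filterS good => nu [n20 b34 b900 cy].
  exact: rigidity_drift n20 (MN nu) (f1 nu) cy b34 b900.
Unshelve. all: by end_near. Qed.
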